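(* Let $\mu\in\mathbb C\setminus\mathbb R$, $\Lambda_\mu=\mathbb Z+\mathbb Z\mu$ and ${}^{\ast}\Lambda_\mu$ its ultrapower. For a hyperfinite set $[F]=[F_i]\subset{}^{\ast}\mathbb Z^2$ and ${}^{\ast}z\in{}^{\ast}\mathbb C\setminus{}^{\ast}\Lambda_\mu$ let $\wp^{\sf nc}_{[F]}({}^{\ast}z)$, $(\wp^{\sf nc}_{[F]})'({}^{\ast}z)$, $g_{1,[F]},g_{2,[F]},g_{3,[F]}\in{}^{\ast}\mathbb C$ be the hyperfinite sums \[\wp^{\sf nc}_{[F]}({}^{\ast}z)=\sum_{({}^{\ast}m,{}^{\ast}n)\in[F]}({}^{\ast}z-({}^{\ast}m\mu+{}^{\ast}n))^{-2},\quad (\wp^{\sf nc}_{[F]})'({}^{\ast}z)=-2\sum_{[F]}({}^{\ast}z-({}^{\ast}m\mu+{}^{\ast}n))^{-3},\] \[g_{1,[F]}=\sum_{[F]\setminus\{0\}}({}^{\ast}m\mu+{}^{\ast}n)^{-2},\ g_{2,[F]}=60\sum_{[F]\setminus\{0\}}({}^{\ast}m\mu+{}^{\ast}n)^{-4},\ g_{3,[F]}=140\sum_{[F]\setminus\{0\}}({}^{\ast}m\mu+{}^{\ast}n)^{-6},\] and let $E_{[F]}(X,Y)=Y^2-4X^3+12g_{1,[F]}X^2-(12g_{1,[F]}^2-g_{2,[F]})X+(4g_{1,[F]}^3-g_{1,[F]}g_{2,[F]}+g_{3,[F]})$. Then for every ${}^{\ast}z\in{}^{\ast}\mathbb C\setminus{}^{\ast}\Lambda_\mu$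 and every $\mathfrak u\in{\sf Cone}(D)$, the element of ${}^{\diamond}\mathbb C_{\mathfrak u}$ represented by the $D$-net $[F]\mapsto E_{[F]}\big(\wp^{\sf nc}_{[F]}({}^{\ast}z),(\wp^{\sf nc}_{[F]})'({}^{\ast}z)\big)$ has absolute value less than every positive element of ${}^{\ast}\mathbb R$ (i.e. the restriction to ${\sf Cone}(D)$ of the pair $(\wp^{\sf nc},(\wp^{\sf nc})')$ solves the $\ast$-infinitesimal Weierstrass equation ${}^{\diamond}E^{\rm class}_\mu(X,Y)\simeq_\ast 0$).
   Context: Fix a nonprincipal ultrafilter $\mathcal V$ on $\mathbb N$; ${}^{\ast}\mathbb Z\subset{}^{\ast}\mathbb R\subset{}^{\ast}\mathbb C$ are the ultrapowers of $\mathbb Z,\mathbb R,\mathbb C$ with respect to $\mathcal V$. A hyperfinite subset of ${}^{\ast}\mathbb Z^2$ is a set $[F_i]$ consisting of the classes of sequences $(x_i)$ with $x_i\in F_i$ for $\mathcal V$-almost all $i$, where each $F_i\subset\mathbb Z^2$ is finite; a hyperfinite sum over $[F_i]$ is the class of the sequence of the corresponding finite sums over $F_i$. $D$ is the set of hyperfinite subsets of ${}^{\ast}\mathbb Z^2$ directed by inclusion; ${\sf Cone}(D)$ is the set of ultrafilters on $D$ containing every cone $\{[F']\in D:[F]\subset[F']\}$, $[F]\in D$. For an ultrafilter $\mathfrak u$ on $D$, ${}^{\diamond}\mathbb C_{\mathfrak u}$ is the ultrapower of ${}^{\ast}\mathbb C$ indexed by $D$ with respect to $\mathfrak u$ (classes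 of $D$-nets of elements of ${}^{\ast}\mathbb C$ modulo agreement on a member of $\mathfrak u$), into which ${}^{\ast}\mathbb C$ embeds via constant nets; absolute values and order are compared in the corresponding ultrapower of ${}^{\ast}\mathbb R$. *)

(* Defs.v *)
From HB Require Import structures.
From mathcomp Require Import all_boot all_order all_algebra finmap.
From mathcomp Require Import boolp classical_sets filter reals complex.

Set Implicit Arguments.
Unset Strict Implicit.
Unset Printing Implicit Defensive.
Import Order.TTheory GRing.Theory Num.Theory.
Local Open Scope classical_set_scope.
Local Open Scope ring_scope.
Local Open Scope complex_scope.
Local Open Scope quotient_scope.

(* Ultrafilters are bundled so that the ring and order structures of an
   ultrapower can be inferred from its type. *)
Record ultrafilter_on (I : Type) := UltrafilterOn {
  ultra_sets :> set I -> Prop;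
  ultra_setsP : UltraFilter ultra_sets }.
#[export] Existing Instance ultra_setsP.

Definition nonprincipal (I : Type) (U : ultrafilter_on I) :=
  forall i : I, ~ U [set i].

Section Ultrapower.
Variables (I : Type) (U : ultrafilter_on I).

Section Quotient.
Variable T : choiceType.

Definition ae_eq (s t : I -> T) : bool := `[< U [set i | s i = t i] >].

Lemma ae_eq_refl : reflexive ae_eq.
Proof. by move=> s; apply/asboolP; apply: filterS filterT => i. Qed.

Lemma ae_eq_sym : symmetric ae_eq.
Proof.
by move=> s t; apply/asboolP/asboolP; apply: filterS => i /= ->.
Qed.

Lemma ae_eq_trans : transitive ae_eq.
Proof.
move=> t s r /asboolP st /asboolP tr; apply/asboolP.
by apply: filterS2 st tr => i /= -> ->.
Qed.

Definition ae_equiv := EquivRel ae_eq ae_eq_refl ae_eq_sym ae_eq_trans.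

Definition ultrapower := {eq_quot ae_equiv}.
HB.instance Definition _ := Choice.on ultrapower.
HB.instance Definition _ := EqQuotient.on ultrapower.

Definition uclass (s : I -> T) : ultrapower := \pi_ultrapower s.

Definition uconst (x : T) : ultrapower := uclass (fun=> x).

Lemma uclass_eq (s t : I -> T) : uclass s = uclass t <-> U [set i | s i = t i].
Proof. by split=> [/eqmodP/asboolP|st] //; apply/eqmodP/asboolP. Qed.

Lemma uclass_repr (x : ultrapower) : uclass (repr x) = x.
Proof. by rewrite /uclass reprK. Qed.

Lemma repr_uclass (s : I -> T) : U [set i | repr (uclass s) i = s i].
Proof. by apply/uclass_eq; rewrite uclass_repr. Qed.

(* The internal subset [A_i] of the ultrapower. *)
Definition internal (A : I -> set T) : set ultrapower :=
  [set x | exists2 s, x = uclass s & U [set i | A i (s i)]].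

Lemma internal_uclass (A : I -> set T) (s : I -> T) :
  internal A (uclass s) <-> U [set i | A i (s i)].
Proof.
split=> [[t /uclass_eq st]|]; last by exists s.
by apply: filterS2 st => i /= ->.
Qed.

End Quotient.

Definition umap (T T' : choiceType) (f : T -> T') (x : ultrapower T) :
  ultrapower T' := uclass (fun i => f (repr x i)).

Definition umap2 (T T' T'' : choiceType) (f : T -> T' -> T'')
    (x : ultrapower T) (y : ultrapower T') : ultrapower T'' :=
  uclass (fun i => f (repr x i) (repr y i)).

Lemma umapE (T T' : choiceType) (f : T -> T') (s : I -> T) :
  umap f (uclass s) = uclass (f \o s).
Proof. by apply/uclass_eq; apply: filterS (repr_uclass s) => i /= ->. Qed.

Lemma umap2E (T T' T'' : choiceType) (f : T -> T' -> T'') s t :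
  umap2 f (uclass s) (uclass t) = uclass (fun i => f (s i) (t i)).
Proof.
apply/uclass_eq.
by apply: filterS2 (repr_uclass s) (repr_uclass t) => i /= -> ->.
Qed.

Lemma ultrapowerW (T : choiceType) (P : ultrapower T -> Prop) :
  (forall s, P (uclass s)) -> forall x, P x.
Proof. by move=> Ps x; rewrite -[x]uclass_repr. Qed.

Section Zmodule.
Variable T : zmodType.

Fact uaddA : associative (@umap2 T T T +%R).
Proof.
elim/ultrapowerW=> s; elim/ultrapowerW=> t; elim/ultrapowerW=> r.
by rewrite !umap2E; congr uclass; apply/funext => i; rewrite addrA.
Qed.

Fact uaddC : commutative (@umap2 T T T +%R).
Proof.
elim/ultrapowerW=> s; elim/ultrapowerW=> t.
by rewrite !umap2E; congr uclass; apply/funext => i; rewrite addrC.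
Qed.

Fact uadd0 : left_id (uconst 0) (@umap2 T T T +%R).
Proof.
elim/ultrapowerW=> s.
by rewrite !umap2E; congr uclass; apply/funext => i; rewrite add0r.
Qed.

Fact uaddN : left_inverse (uconst 0) (umap -%R) (@umap2 T T T +%R).
Proof.
elim/ultrapowerW=> s.
by rewrite umapE umap2E; congr uclass; apply/funext => i /=; rewrite addNr.
Qed.

HB.instance Definition _ :=
  GRing.isZmodule.Build (ultrapower T) uaddA uaddC uadd0 uaddN.
End Zmodule.

Section ComNzRing.
Variable T : comNzRingType.

Fact umulA : associative (@umap2 T T T *%R).
Proof.
elim/ultrapowerW=> s; elim/ultrapowerW=> t; elim/ultrapowerW=> r.
by rewrite !umap2E; congr uclass; apply/funext => i; rewrite mulrA.
Qed.

Fact umulC : commutative (@umap2 T T T *%R).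
Proof.
elim/ultrapowerW=> s; elim/ultrapowerW=> t.
by rewrite !umap2E; congr uclass; apply/funext => i; rewrite mulrC.
Qed.

Fact umul1 : left_id (uconst 1) (@umap2 T T T *%R).
Proof.
elim/ultrapowerW=> s.
by rewrite !umap2E; congr uclass; apply/funext => i; rewrite mul1r.
Qed.

Fact umulDl : left_distributive (@umap2 T T T *%R) (@umap2 T T T +%R).
Proof.
elim/ultrapowerW=> s; elim/ultrapowerW=> t; elim/ultrapowerW=> r.
rewrite !umap2E.
by congr uclass; apply/funext => i; rewrite mulrDl.
Qed.

Fact uone_neq0 : uconst 1 != 0 :> ultrapower T.
Proof.
apply/eqP => /uclass_eq /filter_ex[i /= /eqP].
by rewrite oner_eq0.
Qed.

HB.instance Definition _ := GRing.Zmodule_isComNzRing.Build (ultrapower T)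
  umulA umulC umul1 umulDl uone_neq0.
End ComNzRing.

Section POrder.
Variables (d : Order.disp_t) (T : porderType d).

Definition ule (x y : ultrapower T) : bool :=
  `[< U [set i | (repr x i <= repr y i)%O] >].
Definition ult (x y : ultrapower T) : bool :=
  `[< U [set i | (repr x i < repr y i)%O] >].

Lemma uleE s t : ule (uclass s) (uclass t) <-> U [set i | (s i <= t i)%O].
Proof.
have rs := repr_uclass s; have rt := repr_uclass t.
split=> [/asboolP st|st]; last apply/asboolP; move: rs rt st.
  by apply: filterS3 => i /= -> ->.
by apply: filterS3 => i /= -> ->.
Qed.

Lemma ultE s t : ult (uclass s) (uclass t) <-> U [set i | (s i < t i)%O].
Proof.
have rs := repr_uclass s; have rt := repr_uclass t.
split=> [/asboolP st|st]; last apply/asboolP; move: rs rt st.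
  by apply: filterS3 => i /= -> ->.
by apply: filterS3 => i /= -> ->.
Qed.

Fact ult_def x y : ult x y = (y != x) && ule x y.
Proof.
elim/ultrapowerW: x => s; elim/ultrapowerW: y => t.
apply/idP/andP=> [/ultE st|[/eqP nts /uleE st]].
  split; last by apply/uleE; apply: filterS st => i /ltW.
  apply/eqP => /uclass_eq ts.
  have [i [/= sti tsi]] := filter_ex (filterI st ts).
  by move: sti; rewrite tsi ltxx.
apply/ultE; have [ts|] := in_ultra_setVsetC [set i | t i = s i] (ultra_setsP U).
  by case: nts; apply/uclass_eq.
apply: filterS2 st => i /= lest /eqP neq_ts.
by rewrite lt_def neq_ts.
Qed.

Fact ule_refl : reflexive ule.
Proof.
by elim/ultrapowerW=> s; apply/uleE; apply: filterS filterT => i /=.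
Qed.

Fact ule_anti : antisymmetric ule.
Proof.
elim/ultrapowerW=> s; elim/ultrapowerW=> t /andP[/uleE st /uleE ts].
by apply/uclass_eq; apply: filterS2 st ts => i /= st ts; apply/le_anti/andP.
Qed.

Fact ule_trans : transitive ule.
Proof.
elim/ultrapowerW=> t; elim/ultrapowerW=> s; elim/ultrapowerW=> r.
move=> /uleE st /uleE tr; apply/uleE.
by apply: filterS2 st tr => i /=; apply: le_trans.
Qed.

HB.instance Definition _ := Order.isPOrder.Build d (ultrapower T)
  ult_def ule_refl ule_anti ule_trans.
End POrder.

HB.instance Definition _ (T : porderZmodType) :=
  Order.POrder.on (ultrapower T).

End Ultrapower.

Section Hyperfinite.
Variable V : ultrafilter_on nat.

Local Notation starZ2 := (ultrapower V (int * int)%type).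

Definition internal_fset (F : nat -> {fset int * int}) : set starZ2 :=
  internal (fun i => [set p | p \in F i]).

(* The ultrapower of Z^2 plays the role of the square of the ultrapower of Z:
   a pair of classes ([m_i], [n_i]) is the class [(m_i, n_i)]. *)
Record hyperfinite := Hyperfinite {
  hf_set :> set starZ2;
  hf_setP : exists F : nat -> {fset int * int}, hf_set = internal_fset F }.

Definition hf_seq (F : hyperfinite) : nat -> {fset int * int} :=
  sval (cid (hf_setP F)).

Lemma hf_seqE (F : hyperfinite) : internal_fset (hf_seq F) = F.
Proof. by rewrite /hf_seq; case: cid => /= G ->. Qed.

Lemma internal_fset_inj (F G : nat -> {fset int * int}) :
  internal_fset F = internal_fset G -> V [set i | F i = G i].
Proof.
move=> FG.
have sub (A B : nat -> {fset int * int}) :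
    internal_fset A `<=` internal_fset B -> V [set i | (A i `<=` B i)%fset].
  move=> AB; have [//|nAB] :=
    in_ultra_setVsetC [set i | (A i `<=` B i)%fset] (ultra_setsP V).
  pose s i := if pselect (exists p, (p \in A i) && (p \notin B i)) is left h
              then xchoose h else (0, 0).
  have sP i : ~ (A i `<=` B i)%fset -> (s i \in A i) && (s i \notin B i).
    move=> /negP/fsubsetPn[p pA pB]; rewrite /s; case: pselect => [h|[]].
      exact: (xchooseP h).
    by exists p; rewrite pA.
  have /AB/internal_uclass sB : internal_fset A (uclass V s).
    by apply/internal_uclass; apply: filterS nAB => i /sP /andP[].
  by have [i [/= /sP/andP[_ /negP nB] /nB]] := filter_ex (filterI nAB sB).
have FG' : V [set i | (F i `<=` G i)%fset] by apply: sub; rewrite FG.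
have GF' : V [set i | (G i `<=` F i)%fset] by apply: sub; rewrite FG.
apply: filterS2 FG' GF' => i /= h1 h2.
by apply/eqP; rewrite eqEfsubset h1 h2.
Qed.

Lemma hf_del0P (F : hyperfinite) :
  exists G, hf_set F `\` [set 0] = internal_fset G.
Proof.
exists (fun i => (hf_seq F i `\ (0, 0))%fset); rewrite -{1}(hf_seqE F).
rewrite predeqE; elim/ultrapowerW=> s; split.
  move=> [/internal_uclass sF s0]; apply/internal_uclass.
  have [s00|] := in_ultra_setVsetC [set i | s i = (0, 0)] (ultra_setsP V).
    by case: s0; apply/uclass_eq.
  by apply: filterS2 sF => i /= sF /eqP s0i; rewrite !inE s0i.
move=> /internal_uclass sF; split.
  by apply/internal_uclass; apply: filterS sF => i /=; rewrite !inE => /andP[].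
move=> /uclass_eq s0; have [i [/= + s0i]] := filter_ex (filterI sF s0).
by rewrite s0i !inE eqxx.
Qed.

Definition hf_del0 (F : hyperfinite) : hyperfinite := Hyperfinite (hf_del0P F).

Definition Cone (u : ultrafilter_on hyperfinite) : Prop :=
  forall F : hyperfinite, u [set F' : hyperfinite | F `<=` F'].

Section Sum.
Variable C : nmodType.

(* An internal function on the ultrapower of Z^2 is the class of a sequence of
   functions on Z^2. *)
Definition hf_sum (F : hyperfinite) (f : ultrapower V (int * int -> C)) :
    ultrapower V C :=
  umap2 (fun (A : {fset int * int}) g => \sum_(p <- A) g p)
    (uclass V (hf_seq F)) f.

(* The sum does not depend on the sequence representing the hyperfinite set. *)
Lemma hf_sumE (F : hyperfinite) (G : nat -> {fset int * int})
    (f : nat -> int * int -> C) : hf_set F = internal_fset G ->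
  hf_sum F (uclass V f) = uclass V (fun i => \sum_(p <- G i) f i p).
Proof.
move=> FG; rewrite /hf_sum umap2E; apply/uclass_eq.
have : V [set i | hf_seq F i = G i].
  by apply: internal_fset_inj; rewrite hf_seqE.
by apply: filterS => i /= ->.
Qed.
End Sum.

End Hyperfinite.

Definition lat (C : pzRingType) (mu : C) (p : int * int) : C :=
  p.1%:~R * mu + p.2%:~R.

Definition Lambda (C : pzRingType) (mu : C) : set C := range (lat mu).

Section Weierstrass.
Variables (R : realType) (V : ultrafilter_on nat) (mu : R[i]).

Local Notation starC := (ultrapower V R[i]).

Definition starLambda : set starC := internal (fun=> Lambda mu).

Definition wp (F : hyperfinite V) (z : starC) : starC :=
  hf_sum F (umap (fun (w : R[i]) p => (w - lat mu p) ^- 2) z).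

Definition wp' (F : hyperfinite V) (z : starC) : starC :=
  - 2 * hf_sum F (umap (fun (w : R[i]) p => (w - lat mu p) ^- 3) z).

Definition eisenstein (k : nat) (F : hyperfinite V) : starC :=
  hf_sum (hf_del0 F) (uconst V (fun p => (lat mu p) ^- k)).

Definition g1 F : starC := eisenstein 2 F.
Definition g2 F : starC := 60 * eisenstein 4 F.
Definition g3 F : starC := 140 * eisenstein 6 F.

(* With x = X - g1, this is Y^2 - 4 x^3 + g2 x + g3. *)
Definition E (F : hyperfinite V) (X Y : starC) : starC :=
  Y ^+ 2 - 4 * X ^+ 3 + 12 * g1 F * X ^+ 2
  - (12 * g1 F ^+ 2 - g2 F) * X
  + (4 * g1 F ^+ 3 - g1 F * g2 F + g3 F).

End Weierstrass.

Section Infinitesimal.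
Variables (R : realType) (V : ultrafilter_on nat) (D : Type).
Variable u : ultrafilter_on D.

(* Absolute values land in ultrapowers of R, not of R[i]. *)
Definition star_abs : ultrapower V R[i] -> ultrapower V R :=
  umap (@Normc.normc R).

Definition diamond_abs :
    ultrapower u (ultrapower V R[i]) -> ultrapower u (ultrapower V R) :=
  umap star_abs.

Definition star_infinitesimal (x : ultrapower u (ultrapower V R[i])) : Prop :=
  forall eps : ultrapower V R, 0 < eps -> diamond_abs x < uconst u eps.

End Infinitesimal.

(* Main.v *)
(* The Weierstrass equation holds for the unconditional lattice sums
   x = sum ((z - l)^-2 - l^-2) and y = -2 sum (z - l)^-3, and the net of finite
   partial sums converges to them, so that cofinally many finite index sets make
   the defect smaller than any given positive number; choosing such a finite set
   coordinatewise in the ultrapower gives the required hyperfinite set.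

   The defect f = y^2 - 4 x^3 + g2 x + g3 is periodic, bounded, and tends to 0 at
   the lattice by expansion at 0, and one shows f = 0 without complex integration:
   on closed discs avoiding the lattice f is a uniform limit of polynomials, and
   for polynomials a maximum principle follows from P h * P (- h) = Q (h^2) and
   square roots.  A disc centred at a near-maximum of |f| and almost reaching the
   nearest lattice point, where |f| is small, yields a contradiction. *)
Require Import Defs.
From mathcomp Require Import all_boot all_order all_algebra finmap.
From mathcomp Require Import boolp classical_sets filter reals complex.
From mathcomp Require Import ring lra zify.
Set Implicit Arguments.
Unset Strict Implicit.
Unset Printing Implicit Defensive.
Import Order.TTheory GRing.Theory Num.Theory.
Local Open Scope ring_scope.
Local Open Scope complex_scope.

Local Notation nc := Normc.normc.

(** * Unconditional sums *)

Section Norm.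
Variable R : realType.
Local Notation C := R[i].
Implicit Types x y : C.

Lemma nc_ge0 x : 0 <= nc x.
Proof. by case: x => a b; rewrite sqrtr_ge0. Qed.

Lemma ncM x y : nc (x * y) = nc x * nc y.
Proof. exact: Normc.normcM. Qed.

Lemma nc1 : nc (1 : C) = 1.
Proof. exact: Normc.normc1. Qed.

Lemma nc0 : nc (0 : C) = 0.
Proof. exact: Normc.normc0. Qed.

Lemma ncX x n : nc (x ^+ n) = nc x ^+ n.
Proof. by elim: n => [|n IH]; rewrite ?nc1 // !exprS ncM IH. Qed.

Lemma ncV x : nc x^-1 = (nc x)^-1.
Proof. exact: Normc.normcV. Qed.

Lemma ncVX x n : nc (x ^- n) = nc x^-1 ^+ n.
Proof. by rewrite -exprVn ncX. Qed.

Lemma ncN x : nc (- x) = nc x.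
Proof. exact: normcN. Qed.

Lemma ncB x y : nc (x - y) = nc (y - x).
Proof. by rewrite -ncN opprB. Qed.

Lemma nc_triangle x y : nc (x + y) <= nc x + nc y.
Proof. exact: le_normcD. Qed.

Lemma nc_triangleB x y : nc (x - y) <= nc x + nc y.
Proof. by rewrite -[leRHS]/(nc x + nc y) -(ncN y) nc_triangle. Qed.

Lemma nc_sub_ge x y : nc x - nc y <= nc (x - y).
Proof. by have := nc_triangle (x - y) y; rewrite subrK; lra. Qed.

Lemma nc_dist x y w : nc (x - y) <= nc (x - w) + nc (w - y).
Proof. by rewrite (_ : x - y = (x - w) + (w - y)) ?nc_triangle //; ring. Qed.

Lemma nc_eq0 x : (nc x == 0) = (x == 0).
Proof. by apply/eqP/eqP => [/Normc.eq0_normc|->] //; exact: nc0. Qed.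

Lemma nc_gt0 x : (0 < nc x) = (x != 0).
Proof. by rewrite lt_def nc_ge0 nc_eq0 andbT. Qed.

Lemma nc_real (a : R) : nc a%:C = `|a|.
Proof. by rewrite /= expr0n addr0 sqrtr_sqr. Qed.

Lemma nc_nat n : nc (n%:R : C) = n%:R.
Proof. by rewrite -(rmorph_nat (real_complex R)) nc_real normr_nat. Qed.

Lemma nc_Re x : `|complex.Re x| <= nc x.
Proof.
case: x => a b /=; rewrite -sqrtr_sqr ler_wsqrtr //.
by rewrite lerDl sqr_ge0.
Qed.

Lemma nc_Im x : `|complex.Im x| <= nc x.
Proof.
case: x => a b /=; rewrite -sqrtr_sqr ler_wsqrtr //.
by rewrite lerDr sqr_ge0.
Qed.

Lemma nc_sum (I : Type) (s : seq I) (f : I -> C) :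
  nc (\sum_(i <- s) f i) <= \sum_(i <- s) nc (f i).
Proof.
elim: s => [|i s IH]; first by rewrite !big_nil nc0.
by rewrite !big_cons (le_trans (nc_triangle _ _)) // lerD2l.
Qed.

Lemma nc_eq0P x : (forall e : R, 0 < e -> nc x <= e) -> x = 0.
Proof.
move=> h; apply/eqP; rewrite -nc_eq0; apply/negP => /negP n0.
have x0 : 0 < nc x by rewrite lt_def n0 nc_ge0.
by have := h (nc x / 2) ltac:(lra); lra.
Qed.

Lemma parallelogram x y :
  nc (x - y) ^+ 2 + nc (x + y) ^+ 2 = 2 * (nc x ^+ 2 + nc y ^+ 2).
Proof.
case: x => a b; case: y => c d /=.
by rewrite !sqr_sqrtr ?addr_ge0 ?sqr_ge0 //; ring.
Qed.

End Norm.

(** * Limits along finite subsets, and dominated sums *)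

Section Nets.
Variables (R : realType) (I : choiceType).
Local Notation C := R[i].
Implicit Types (phi psi : {fset I} -> C) (f g : I -> C).
Local Open Scope fset_scope.
Local Open Scope ring_scope.

Definition tends phi (s : C) := forall e : R, 0 < e ->
  exists F0, forall F, F0 `<=` F -> nc (phi F - s) <= e.

Lemma tends_uniq phi s t : tends phi s -> tends phi t -> s = t.
Proof.
move=> hs ht; apply/eqP; rewrite -subr_eq0; apply/eqP/nc_eq0P => e e0.
have [F h] := hs (e / 2) ltac:(lra); have [G k] := ht (e / 2) ltac:(lra).
have := h (F `|` G) (fsubsetUl _ _); have := k (F `|` G) (fsubsetUr _ _).
by have := nc_dist s t (phi (F `|` G)); rewrite (ncB s (phi _)); lra.
Qed.

Lemma tends_cst c : tends (fun=> c) c.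
Proof. by move=> e e0; exists fset0 => F _; rewrite subrr nc0 ltW. Qed.

Lemma tendsD phi psi s t :
  tends phi s -> tends psi t -> tends (fun F => phi F + psi F) (s + t).
Proof.
move=> hs ht e e0.
have [F h] := hs (e / 2) ltac:(lra); have [G k] := ht (e / 2) ltac:(lra).
exists (F `|` G) => H; rewrite fsubUset => /andP[/h FH /k GH].
rewrite (_ : _ - _ = (phi H - s) + (psi H - t)); last by ring.
by have := nc_triangle (phi H - s) (psi H - t); lra.
Qed.

Lemma tendsM phi psi s t :
  tends phi s -> tends psi t -> tends (fun F => phi F * psi F) (s * t).
Proof.
move=> hs ht e e0; pose K := nc s + nc t + 1.
have s0 := nc_ge0 s; have t0 := nc_ge0 t.
have K0 : 0 < K by rewrite /K; lra.
(* When both errors are at most [d <= 1], the product errs by at most [d * (d + nc t + nc s)], hence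
   by at most [d * K]. *)
pose d := Num.min 1 (e / (2 * K)).
have d0 : 0 < d by rewrite lt_min ltr01 divr_gt0 // mulr_gt0.
have d1 : d <= 1 by rewrite ge_min lexx.
have dK : d * (2 * K) <= e by rewrite -ler_pdivlMr ?mulr_gt0 // ge_min lexx orbT.
have [F h] := hs d d0; have [G k] := ht d d0.
exists (F `|` G) => H; rewrite fsubUset => /andP[/h FH /k GH].
rewrite (_ : _ - _ = (phi H - s) * (psi H - t) + (phi H - s) * t + s * (psi H - t));
  last by ring.
apply: le_trans (nc_triangle _ _) _.
have := nc_triangle ((phi H - s) * (psi H - t)) ((phi H - s) * t).
rewrite !ncM /K in dK *; move: FH GH.
set a := nc (phi H - s); set b := nc (psi H - t) => FH GH.
have a0 : 0 <= a by apply: nc_ge0.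
have b0 : 0 <= b by apply: nc_ge0.
nra.
Qed.

Lemma tendsMl c phi s : tends phi s -> tends (fun F => c * phi F) (c * s).
Proof. exact: tendsM (tends_cst c). Qed.

Lemma tendsB phi psi s t :
  tends phi s -> tends psi t -> tends (fun F => phi F - psi F) (s - t).
Proof.
move=> hs ht; have := tendsD hs (tendsMl (-1) ht).
by under [X in tends X _]eq_fun do rewrite mulN1r; rewrite mulN1r.
Qed.

Lemma tendsX phi s n : tends phi s -> tends (fun F => phi F ^+ n) (s ^+ n).
Proof.
move=> h; elim: n => [|n IH]; first exact: tends_cst.
by rewrite exprS; under [X in tends X _]eq_fun do rewrite exprS; apply: tendsM.
Qed.

Lemma tends_nc_le phi s (B : R) :
  tends phi s -> (forall F, nc (phi F) <= B) -> nc s <= B.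
Proof.
move=> h hB; rewrite leNgt; apply/negP => Bs.
have [F k] := h ((nc s - B) / 2) ltac:(lra).
have := k F (fsubset_refl _); have := hB F.
by rewrite ncB; have := nc_sub_ge s (phi F); lra.
Qed.

Definition has_sum f (s : C) := tends (fun F => \sum_(i <- F) f i) s.

Lemma has_sum_uniq f s t : has_sum f s -> has_sum f t -> s = t.
Proof. exact: tends_uniq. Qed.

Lemma eq_has_sum f g s : f =1 g -> has_sum f s -> has_sum g s.
Proof. by move=> /funext ->. Qed.

Lemma has_sumB f g s t :
  has_sum f s -> has_sum g t -> has_sum (fun i => f i - g i) (s - t).
Proof.
move=> hs ht; have := tendsB hs ht.
by under [X in tends X _]eq_fun do rewrite -sumrB.
Qed.

Lemma has_sumZ c f s : has_sum f s -> has_sum (fun i => c * f i) (c * s).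
Proof.
by move=> hs; have := tendsMl c hs; under [X in tends X _]eq_fun do rewrite mulr_sumr.
Qed.

Lemma has_sumN f s : has_sum f s -> has_sum (fun i => - f i) (- s).
Proof.
by move=> /(has_sumZ (-1)); rewrite mulN1r; under [X in has_sum X _]eq_fun do rewrite mulN1r.
Qed.

Lemma has_sumD f g s t :
  has_sum f s -> has_sum g t -> has_sum (fun i => f i + g i) (s + t).
Proof.
move=> hs ht; have := tendsD hs ht.
by under [X in tends X _]eq_fun do rewrite -big_split.
Qed.

Lemma has_sum_reindex f s (h k : I -> I) :
  cancel h k -> cancel k h -> has_sum f s -> has_sum (f \o h) s.
Proof.
move=> hk kh fs e /fs[F0 F0P]; exists (k @` F0) => F F0F.
have -> : \sum_(i <- F) (f \o h) i = \sum_(j <- h @` F) f j.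
  by rewrite big_imfset //= => i j _ _; apply: (can_inj hk).
apply: F0P; apply/fsubsetP => j jF0; apply/imfsetP; exists (k j); last by rewrite kh.
by apply: (fsubsetP F0F); apply: in_imfset.
Qed.

(** Reindexing by [h] turns the sum into its negative, and unconditional sums are unique. *)
Lemma has_sum_odd f s (h : I -> I) :
  involutive h -> (forall i, f (h i) = - f i) -> has_sum f s -> s = 0.
Proof.
move=> hh fh fs; have fhs := has_sum_reindex hh hh fs.
have : s = - s.
  apply: has_sum_uniq fhs _; rewrite (_ : f \o h = (fun i => - f i)).
    exact: has_sumN.
  by apply: funext => i /=.
move=> /eqP; rewrite -addr_eq0 -mulr2n mulrn_eq0 /= => /eqP //.
Qed.

Lemma has_sum_pred1 j c : has_sum (fun i => if i == j then c else 0) c.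
Proof.
move=> e e0; exists [fset j] => F; rewrite fsub1set => jF.
rewrite (big_fsetD1 j jF) /= eqxx big_seq big1 ?addr0 ?subrr ?nc0 ?ltW //.
by move=> i; rewrite !inE => /andP[/negPf ->].
Qed.

Definition summable (b : I -> R) :=
  (forall i, 0 <= b i) /\ exists B, forall F : {fset I}, \sum_(i <- F) b i <= B.

Lemma summableZ K b : 0 <= K -> summable b -> summable (fun i => K * b i).
Proof.
move=> K0 [b0 [B hB]]; split=> [i|]; first by rewrite mulr_ge0.
by exists (K * B) => F; rewrite -mulr_sumr ler_wpM2l.
Qed.

Lemma summable_tail b : summable b -> forall e, 0 < e ->
  exists F0 : {fset I}, forall F, F0 `<=` F -> \sum_(i <- F) b i - \sum_(i <- F0) b i <= e.
Proof.
move=> [b0 [B hB]] e e0.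
pose A : set R := fun x => exists F : {fset I}, x = \sum_(i <- F) b i.
have sA : has_sup A.
  by split; [exists (\sum_(i <- fset0) b i); exists fset0
            |exists B => x [F ->]].
have [x [F0 ->] lt] := sup_adherent e0 sA.
exists F0 => F _; have : \sum_(i <- F) b i <= sup A.
  by apply: ub_le_sup; [exact: sA.2|exists F].
by move: lt; lra.
Qed.

Lemma sum_fsetD (V : zmodType) (f : I -> V) (F0 F : {fset I}) : F0 `<=` F ->
  \sum_(i <- F) f i - \sum_(i <- F0) f i = \sum_(i <- F `\` F0) f i.
Proof.
move=> s; rewrite (big_fsetID _ (mem F0)) /= addrAC.
rewrite (_ : [fset x in F | x \in F0] = F0); last first.
  apply/fsetP => i; rewrite !inE /= andbC.
  by case: (boolP (i \in F0)) => //= /(fsubsetP s) ->.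
rewrite subrr add0r; apply: eq_fbigl => i.
by rewrite !inE /= andbC.
Qed.

Lemma summable_cauchy b : summable b -> forall e, 0 < e ->
  exists F0 : {fset I}, forall f, (forall i, nc (f i) <= b i) ->
    forall F, F0 `<=` F -> nc (\sum_(i <- F) f i - \sum_(i <- F0) f i) <= e.
Proof.
move=> sb e /(summable_tail sb)[F0 h]; exists F0 => f fb F s.
rewrite sum_fsetD //; apply: le_trans (nc_sum _ _) _.
by apply: le_trans (h F s); rewrite sum_fsetD // ler_sum.
Qed.

(* For real-valued g with |g| <= b the sums of g + b are monotone, hence converge
   to their supremum. *)
Lemma summable_real_sum b (g : I -> R) : summable b ->
  (forall i, `|g i| <= b i) -> exists s, has_sum (fun i => (g i)%:C) s%:C.
Proof.
move=> [b0 [B hB]] gb.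
have mono (c : I -> R) : summable c -> exists s, has_sum (fun i => (c i)%:C) s%:C.
  move=> sc; pose A : set R := fun x => exists F : {fset I}, x = \sum_(i <- F) c i.
  have sA : has_sup A.
    case: sc => _ [D hD]; by split; [exists (\sum_(i <- fset0) c i); exists fset0
            |exists D => x [F ->]].
  exists (sup A) => e e0; have [x [F0 ->] lt] := sup_adherent e0 sA.
  exists F0 => F F0F; rewrite -(rmorph_sum (real_complex R)) -rmorphB nc_real.
  have hle : \sum_(i <- F) c i <= sup A.
    by apply: ub_le_sup; [exact: sA.2|exists F].
  have : 0 <= \sum_(i <- F) c i - \sum_(i <- F0) c i.
    by rewrite sum_fsetD //; apply: sumr_ge0 => i _; case: sc.
  by rewrite ler_norml; move: lt hle; lra.
have [|s hs] := mono (fun i => g i + b i).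
  split=> [i|]; first by have := gb i; rewrite ler_norml; lra.
  exists (2 * B) => F; apply: (@le_trans _ _ (\sum_(i <- F) 2 * b i)).
    by apply: ler_sum => i _; have := gb i; rewrite ler_norml; lra.
  by rewrite -mulr_sumr; have := hB F; lra.
have [|t ht] := mono b; first by split=> //; exists B.
exists (s - t); rewrite rmorphB; have := has_sumB hs ht.
by under eq_fun do rewrite -rmorphB addrK.
Qed.

Lemma summable_has_sum b f : summable b -> (forall i, nc (f i) <= b i) ->
  exists s, has_sum f s.
Proof.
move=> sb fb.
have [i|s hs] := summable_real_sum (g := fun i => complex.Re (f i)) sb.
  exact: le_trans (nc_Re _) (fb i).
have [i|t ht] := summable_real_sum (g := fun i => complex.Im (f i)) sb.
  exact: le_trans (nc_Im _) (fb i).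
exists (s%:C + 'i * t%:C); have := has_sumD hs (has_sumZ 'i ht).
by under eq_fun do rewrite -complexE.
Qed.

(** The Weierstrass M-test: [F0] comes from the tail of [b] alone, so it serves every dominated [f]
    at once. For terms depending on a parameter this is uniform convergence. *)
Lemma summable_uniform b : summable b -> forall e, 0 < e ->
  exists F0 : {fset I}, forall f s, (forall i, nc (f i) <= b i) -> has_sum f s ->
    nc (s - \sum_(i <- F0) f i) <= e.
Proof.
move=> sb e e0; have [F0 h] := summable_cauchy sb (e := e / 2) ltac:(lra).
exists F0 => f s fb fs; have [F1 k] := fs (e / 2) ltac:(lra).
have := h f fb (F0 `|` F1) (fsubsetUl _ _); have := k (F0 `|` F1) (fsubsetUr _ _).
have := nc_dist s (\sum_(i <- F0) f i) (\sum_(i <- F0 `|` F1) f i).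
by rewrite (ncB s (\sum_(i <- F0 `|` F1) f i)); lra.
Qed.

Lemma summable_small b : summable b -> forall e, 0 < e ->
  exists F0 : {fset I}, forall i, i \notin F0 -> b i <= e.
Proof.
move=> sb e /(summable_tail sb)[F0 h]; exists F0 => i iF0.
by have := h _ (fsubsetU1 i F0); rewrite big_fsetU1 // addrK.
Qed.

(** The default 0 makes the lattice series total functions of [z]; the value has meaning only where
    a sum exists. *)
Definition usum f : C := xget 0 (has_sum f).

Lemma usumP f s : has_sum f s -> has_sum f (usum f).
Proof. by move=> fs; apply: (@xgetPex _ 0 (has_sum f)); exists s. Qed.

Lemma usumE f s : has_sum f s -> usum f = s.
Proof. by move=> fs; apply: has_sum_uniq (usumP fs) fs. Qed.

Lemma has_sum_le b f s (B : R) : has_sum f s -> (forall i, nc (f i) <= b i) ->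
  (forall F : {fset I}, \sum_(i <- F) b i <= B) -> nc s <= B.
Proof.
move=> fs fb hB; apply: tends_nc_le fs _ => F.
by apply: le_trans (nc_sum _ _) (le_trans _ (hB F)); apply: ler_sum.
Qed.

End Nets.

(** * A maximum principle on the unit disc *)

Section DiscAlgebra.
Variable R : realType.
Local Notation C := R[i].
Implicit Types (P Q : {poly C}) (g : C -> C).

(** Of the two roots take the one closer to 1. The parallelogram law then gives
    [2 <= nc (s + 1) ^+ 2], and [s ^+ 2 - 1] factors as [(s - 1) * (s + 1)]. *)
Lemma unit_sqrt (w : C) : nc w = 1 ->
  exists s, [/\ s ^+ 2 = w, nc s = 1 & nc (s - 1) ^+ 2 <= nc (w - 1) ^+ 2 / 2].
Proof.
move=> w1.
suff [s [sw s1 le]] : exists s, [/\ s ^+ 2 = w, nc s = 1 & nc (s - 1) <= nc (s + 1)].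
  exists s; split=> //; rewrite -sw (_ : s ^+ 2 - 1 = (s - 1) * (s + 1)); last by ring.
  rewrite ncM exprMn; have := parallelogram s 1; rewrite s1 nc1.
  have := nc_ge0 (s - 1); have := nc_ge0 (s + 1).
  move: (nc (s - 1)) (nc (s + 1)) le => a b le b0 a0 ab.
  have b2 : 2 <= b ^+ 2 by nra.
  by rewrite ler_pdivlMr // ler_wpM2l // sqr_ge0.
pose s := sqrtc w; have sw : s ^+ 2 = w by rewrite sqr_sqrtc.
have s1 : nc s = 1.
  apply/eqP; rewrite -(eqrXn2 (n := 2)) ?nc_ge0 //.
  by rewrite -ncX sw w1 expr1n.
have [le|/ltW le] := leP (nc (s - 1)) (nc (s + 1)); first by exists s.
exists (- s); split; [by rewrite sqrrN|by rewrite ncN|].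
by rewrite -ncN opprD !opprK -[leRHS]ncN opprD opprK.
Qed.

Lemma horner_even_odd P h :
  P.[h] = (even_poly P).[h ^+ 2] + h * (odd_poly P).[h ^+ 2].
Proof.
by rewrite -{1}(poly_even_odd P) hornerD hornerM !horner_comp !hornerE mulrC.
Qed.

(** The mean of [P] at [s] and [- s] is the even part of [P] at [s ^+ 2]. As [s ^+ 2] covers the
    unit circle, the even part inherits the bound; it has the same value at 0 and about half the
    size. *)
Lemma poly_weak_max P (K : R) : (forall h, nc h = 1 -> nc P.[h] <= K) -> nc P.[0] <= K.
Proof.
have [n] := ubnP (size P); elim: n P => // n IH P sP hP.
have [s1|s1] := leqP (size P) 1.
  by have := hP 1 (nc1 R); rewrite (size1_polyC s1) !hornerC.
have -> : P.[0] = (even_poly P).[0].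
  by rewrite horner_even_odd mul0r addr0 expr0n.
apply: IH => [|w w1].
  apply: leq_ltn_trans (size_even_poly _) _.
  by move: sP s1; rewrite uphalf_half; lia.
have [s [sw ss _]] := unit_sqrt w1.
have := hP s ss; have := hP (- s); rewrite ncN => /(_ ss).
rewrite (horner_even_odd P s) (horner_even_odd P (- s)) sqrrN sw mulNr => h1 h2.
have := nc_triangle ((even_poly P).[w] - s * (odd_poly P).[w])
  ((even_poly P).[w] + s * (odd_poly P).[w]).
rewrite (_ : _ + _ = 2%:R * (even_poly P).[w]); last by ring.
by rewrite ncM nc_nat; lra.
Qed.

(* P h * P (- h) is a polynomial in h ^+ 2, and the square root closer to 1 halves
   the squared distance of a unit number to 1. *)
Lemma poly_strong_max k P (M M' : R) : 0 <= M' ->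
  (forall h, nc h = 1 -> nc P.[h] <= M) ->
  (forall h, nc h = 1 -> nc (h - 1) ^+ 2 <= 4 / 2 ^+ k -> nc P.[h] <= M') ->
  nc P.[0] ^+ (2 ^ k) <= M' * M ^+ (2 ^ k).-1.
Proof.
elim: k P M M' => [|k IH] P M M' M'0 hM hM'.
  (* For [k = 0] the arc is the whole circle, because [nc (h - 1) <= 2]. *)
  rewrite expn0 expr1 expr0 mulr1; apply: poly_weak_max => h h1; apply: hM' => //.
  rewrite expr0 divr1; have := nc_triangleB h 1; rewrite h1 nc1 => le.
  rewrite (_ : 4 = (1 + 1) ^+ 2); last by ring.
  by rewrite ler_sqr ?nnegrE ?nc_ge0 ?addr_ge0.
have M0 : 0 <= M by apply: le_trans (nc_ge0 _) (hM 1 (nc1 R)).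
pose Q := even_poly P ^+ 2 - 'X * odd_poly P ^+ 2.
have QE h : Q.[h ^+ 2] = P.[h] * P.[- h].
  rewrite (horner_even_odd P h) (horner_even_odd P (- h)) sqrrN /Q.
  rewrite hornerD hornerN horner_exp (hornerM 'X) hornerX horner_exp.
  ring.
have Q0 := QE 0; rewrite expr0n oppr0 -expr2 in Q0.
(* [Q] is bounded by [M ^+ 2] on the circle and by [M' * M] on the arc; the exponents match since 1
   + 2(2^k - 1) = 2^(k+1) - 1. *)
have EM : M' * M * (M ^+ 2) ^+ (2 ^ k).-1 = M' * M ^+ (2 ^ k.+1).-1.
  rewrite -mulrA -exprM -exprS; congr (_ * _ ^+ _).
  by rewrite expnS; have := expn_gt0 2 k; lia.
rewrite -EM expnS exprM -ncX -Q0.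
apply: IH.
- exact: mulr_ge0.
- move=> w /unit_sqrt[s [<- s1 _]]; rewrite QE ncM.
  by apply: ler_pM; rewrite ?nc_ge0 // hM // ncN.
move=> w /unit_sqrt[s [<- s1 le]] wk; rewrite QE ncM.
apply: ler_pM; rewrite ?nc_ge0 //; last by rewrite hM // ncN.
apply: hM' => //; apply: le_trans le _.
by rewrite ler_pdivrMr // [2 ^+ k.+1]exprSr invfM mulrA divfK ?pnatr_eq0 //.
Qed.

Definition disc_algebra g := forall e : R, 0 < e ->
  exists P, forall h, nc h <= 1 -> nc (g h - P.[h]) <= e.

(** Approximate [g] by a polynomial within [M * x], where [2 * x] is the gain claimed. If the claim
    failed, then [nc P.[0]] would exceed [M * (1 - 3 * x)], and its [N]-th power would contradict
    [poly_strong_max] for [N = 2 ^ k]. *)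
Lemma disc_strong_max k g (M : R) : disc_algebra g -> 0 < M ->
  (forall h, nc h = 1 -> nc (g h) <= M) ->
  (forall h, nc h = 1 -> nc (h - 1) ^+ 2 <= 4 / 2 ^+ k -> nc (g h) <= M / 2) ->
  nc (g 0) <= M * (1 - (8 * 2 ^+ k)^-1).
Proof.
move=> hg M0 hM hM'; pose N := (2 ^ k)%N; pose x : R := (16 * 2 ^+ k)^-1.
have N0 : (0 < N)%N by rewrite expn_gt0.
have NE : (N%:R : R) = 2 ^+ k by rewrite natrX.
have k1 : 1 <= 2 ^+ k :> R by rewrite exprn_ege1 // ler1n.
have Nx : N%:R * x = 16^-1 by rewrite NE /x; field; rewrite gt_eqF //; lra.
have x0 : 0 < x by rewrite invr_gt0; lra.
have x8 : x <= 16^-1 by rewrite lef_pV2 ?posrE //; lra.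
have [P hP] := hg (M * x) (mulr_gt0 M0 x0).
have PM h : nc h = 1 -> nc P.[h] <= nc (g h) + M * x.
  move=> h1; have := hP h; rewrite h1 ncB => /(_ (lexx _)).
  by have := nc_triangle (P.[h] - g h) (g h); rewrite subrK; lra.
have le : nc P.[0] ^+ N <= M * (2^-1 + x) * (M * (1 + x)) ^+ N.-1.
  apply: poly_strong_max => [|h h1|h h1 hk]; first by apply: mulr_ge0; lra.
    by have := PM h h1; have := hM h h1; lra.
  by have := PM h h1; have := hM' h h1 hk; lra.
rewrite leNgt; apply/negP => gt0.
have : M * (1 - 3 * x) < nc P.[0].
  have := hP 0; rewrite nc0 => /(_ ler01).
  have := nc_sub_ge (g 0) (g 0 - P.[0]); rewrite subKr.
  move: gt0; rewrite (_ : (8 * _)^-1 = 2 * x); last by rewrite /x; field; lra.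
  lra.
move=> lt; have : (M * (1 - 3 * x)) ^+ N <= nc P.[0] ^+ N.
  apply: lerXn2r; rewrite ?nnegrE ?nc_ge0 ?(ltW lt) //.
  by apply: mulr_ge0; lra.
move=> /le_trans/(_ le); rewrite !exprMn.
have -> : M * (2^-1 + x) * (M ^+ N.-1 * (1 + x) ^+ N.-1)
  = M ^+ N * ((2^-1 + x) * (1 + x) ^+ N.-1).
  by rewrite -[in RHS](prednK N0) exprS; ring.
rewrite ler_pM2l ?exprn_gt0 //.
(* Since [N * x = 1/16], Bernoulli bounds (1 - 3x)^N below by 13/16. Also (1 + x)^(N-1) is at most
   the inverse of (1 - x)^(N-1), hence at most 16/15, so the other side is at most 9/16 * 16/15 =
   3/5. *)
have bern n (y : R) : 0 <= y <= 1 -> 1 - n%:R * y <= (1 - y) ^+ n.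
  move=> /andP[y0 y1]; elim: n => [|n IHn]; first by rewrite mul0r subr0 expr0.
  rewrite exprS -natr1; have : 0 <= n%:R :> R by [].
  nra.
have b1 := bern N (3 * x) ltac:(lra); have b2 : 15 / 16 <= (1 - x) ^+ N.-1.
  apply: le_trans (bern _ _ _); last by lra.
   have : N.-1%:R * x <= N%:R * x.
    by rewrite ler_pM2r // ler_nat leq_pred.
  by rewrite Nx; lra.
have b3 : (1 + x) ^+ N.-1 * (1 - x) ^+ N.-1 <= 1.
  by rewrite -exprMn exprn_ile1 //; nra.
have b4 : 0 <= (1 + x) ^+ N.-1 by rewrite exprn_ge0; lra.
rewrite mulrCA Nx in b1.
by move: b1 b2 b3 b4; move: (_ ^+ N) (_ ^+ N.-1) (_ ^+ N.-1) => a b c; nra.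
Qed.

Lemma disc_algebra_cst c : disc_algebra (fun=> c).
Proof. by move=> e e0; exists c%:P => h _; rewrite hornerC subrr nc0 ltW. Qed.

Lemma disc_algebraD f g :
  disc_algebra f -> disc_algebra g -> disc_algebra (fun h => f h + g h).
Proof.
move=> hf hg e e0.
have [P hP] := hf (e / 2) ltac:(lra); have [Q hQ] := hg (e / 2) ltac:(lra).
exists (P + Q) => h h1; have := hP h h1; have := hQ h h1.
have := nc_triangle (f h - P.[h]) (g h - Q.[h]).
rewrite hornerD (_ : f h - P.[h] + (g h - Q.[h]) = f h + g h - (P.[h] + Q.[h])).
  by lra.
by ring.
Qed.

Lemma disc_algebra_bounded g : disc_algebra g ->
  exists2 K, 0 <= K & forall h, nc h <= 1 -> nc (g h) <= K.
Proof.
move=> hg; have [P hP] := hg 1 ltr01.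
exists (1 + \sum_(i < size P) nc P`_i) => [|h h1].
  by rewrite addr_ge0 // sumr_ge0 // => i _; exact: nc_ge0.
have := nc_triangle (g h - P.[h]) P.[h]; rewrite subrK => /le_trans; apply.
apply: lerD; first exact: hP.
rewrite horner_coef; apply: le_trans (nc_sum _ _) _; apply: ler_sum => i _.
by rewrite ncM ncX ler_piMr ?nc_ge0 // exprn_ile1 ?nc_ge0.
Qed.

Lemma disc_algebraM f g :
  disc_algebra f -> disc_algebra g -> disc_algebra (fun h => f h * g h).
Proof.
move=> hf hg e e0.
have [K K0 hK] := disc_algebra_bounded hf; have [L L0 hL] := disc_algebra_bounded hg.
pose d := Num.min 1 (e / (K + L + 1)).
have KL : 0 < K + L + 1 by lra.
have d0 : 0 < d by rewrite lt_min ltr01 divr_gt0.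
have d1 : d <= 1 by rewrite ge_min lexx.
have dK : d * (K + L + 1) <= e by rewrite -ler_pdivlMr // ge_min lexx orbT.
have [P hP] := hf d d0; have [Q hQ] := hg d d0.
exists (P * Q) => h h1; rewrite hornerM.
have := hP h h1; have := hQ h h1; have := hK h h1; have := hL h h1.
have := nc_triangle (f h * (g h - Q.[h]) + g h * (f h - P.[h]))
  (- ((f h - P.[h]) * (g h - Q.[h]))).
have := nc_triangle (f h * (g h - Q.[h])) (g h * (f h - P.[h])).
have -> : f h * g h - P.[h] * Q.[h] = f h * (g h - Q.[h]) + g h * (f h - P.[h])
  + - ((f h - P.[h]) * (g h - Q.[h])) by ring.
rewrite ncN !ncM.
have := nc_ge0 (f h); have := nc_ge0 (g h).
have := nc_ge0 (f h - P.[h]); have := nc_ge0 (g h - Q.[h]).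
move: (nc (f h)) (nc (g h)) (nc (f h - _)) (nc (g h - _)) => a b x y.
move=> y0 x0 b0 a0 t1 t2 bL aK yd xd.
have := ler_pM a0 y0 aK yd; have := ler_pM b0 x0 bL xd.
have := ler_pM x0 y0 xd yd; have : d * d <= d by rewrite ler_piMr // ltW.
lra.
Qed.

Lemma disc_algebraX g n : disc_algebra g -> disc_algebra (fun h => g h ^+ n).
Proof.
move=> hg; elim: n => [|n IH]; first exact: disc_algebra_cst.
by under eq_fun do rewrite exprS; apply: disc_algebraM.
Qed.

Lemma disc_algebra_sum (I : Type) (s : seq I) (f : I -> C -> C) :
  (forall i, disc_algebra (f i)) -> disc_algebra (fun h => \sum_(i <- s) f i h).
Proof.
move=> hf; elim: s => [|i s IH].
  by under eq_fun do rewrite big_nil; exact: disc_algebra_cst.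
by under eq_fun do rewrite big_cons; apply: disc_algebraD.
Qed.

Lemma disc_algebra_lim g :
  (forall e, 0 < e -> exists2 f, disc_algebra f &
    forall h, nc h <= 1 -> nc (g h - f h) <= e) -> disc_algebra g.
Proof.
move=> hg e e0; have [f hf gf] := hg (e / 2) ltac:(lra).
have [P hP] := hf (e / 2) ltac:(lra); exists P => h h1.
by have := gf h h1; have := hP h h1; have := nc_dist (g h) P.[h] (f h); lra.
Qed.

(** With [d = 1 - q] one has [q * (1 + d) <= 1], and [(1 + d) ^+ n] grows at least linearly by
    Bernoulli. *)
Lemma geometric_small (q e : R) : 0 <= q < 1 -> 0 < e -> exists n, q ^+ n <= e.
Proof.
move=> /andP[q0 q1] e0; pose d := 1 - q.
have d0 : 0 < d by rewrite subr_gt0.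
exists (Num.bound (d * e)^-1); set n := Num.bound _.
have hn : (d * e)^-1 < n%:R.
  by apply: le_lt_trans (archi_boundP _); rewrite ?ler_norm // invr_ge0 mulr_ge0 // ltW.
have b m : 1 + m%:R * d <= (1 + d) ^+ m.
  elim: m => [|m IH]; first by rewrite mul0r addr0 expr0.
  by rewrite exprS -natr1; have : 0 <= m%:R :> R by []; nra.
have : q ^+ n * (1 + d) ^+ n <= 1.
  by rewrite -exprMn exprn_ile1 // /d; nra.
have qn : 0 <= q ^+ n by rewrite exprn_ge0.
have : 1 < n%:R * (d * e) by rewrite -ltr_pdivrMr ?mulr_gt0 // mul1r.
have := b n; move: (q ^+ n) qn ((1 + d) ^+ n) => x x0 y h1 h2 h3.
rewrite leNgt; apply/negP => ex.
have : x * (1 + n%:R * d) <= 1 by apply: le_trans h3; rewrite ler_wpM2l.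
by have : 0 <= n%:R :> R by []; nra.
Qed.

(** The pole lies outside the closed disc, so the geometric series in [t = - w / a * h] converges
    uniformly. Truncation at [n] errs by at most q^n / (|a| (1 - q)), which dictates the choice of
    [n]. *)
Lemma disc_algebra_inv (a w : C) : nc w < nc a -> disc_algebra (fun h => (a + w * h)^-1).
Proof.
move=> wa e e0; have a0 : 0 < nc a by apply: le_lt_trans wa; exact: nc_ge0.
have an0 : a != 0 by rewrite -nc_gt0.
pose q := nc w / nc a.
have q01 : 0 <= q < 1 by rewrite divr_ge0 ?nc_ge0 // ltr_pdivrMr ?mul1r.
have q1 : 0 < 1 - q by lra.
have [n hn] := geometric_small q01 (mulr_gt0 (mulr_gt0 e0 q1) a0).
exists (\poly_(i < n) (a^-1 * (- w / a) ^+ i)) => h h1.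
pose t := - w / a * h.
have tq : nc t <= q.
  by rewrite /t !ncM ncN ncV ler_piMr // divr_ge0 ?nc_ge0.
have t1 : 1 - q <= nc (1 - t) by have := nc_sub_ge 1 t; rewrite nc1; lra.
have tn0 : 1 - t != 0 by rewrite -nc_gt0; lra.
have -> : (a + w * h)^-1 = a^-1 * (1 - t)^-1.
  by rewrite -invfM; congr (_^-1); rewrite /t; field.
rewrite horner_poly.
have -> : \sum_(i < n) a^-1 * (- w / a) ^+ i * h ^+ i = a^-1 * ((1 - t ^+ n) / (1 - t)).
  have -> : (1 - t ^+ n) / (1 - t) = \sum_(i < n) t ^+ i.
    apply: (mulIf tn0); rewrite divfK // [RHS]mulrC -[LHS]opprB subrX1.
    by rewrite -mulNr opprB.
  by rewrite mulr_sumr; apply: eq_bigr => i _; rewrite -mulrA -exprMn.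
rewrite -mulrBr -[X in X - _]mul1r -mulrBl opprB addrC subrK.
rewrite !ncM !ncV ncX.
have : nc t ^+ n <= q ^+ n by rewrite lerXn2r ?nnegrE ?nc_ge0 //; lra.
move=> /le_trans/(_ hn) le.
rewrite mulrC ler_pdivrMr // ler_pdivrMr; last by lra.
by apply: le_trans le _; have := ler_wpM2l (ltW (mulr_gt0 e0 a0)) t1; lra.
Qed.

End DiscAlgebra.

(** * Lattice sums *)

Section Weight.
Variable R : realType.
Implicit Types p : (int * int)%type.

(** The summand 1 keeps the weight invertible at the origin, so a single majorant [weight p ^- 3]
    covers all indices. *)
Definition weight p : R := 1 + `|p.1%:~R| + `|p.2%:~R|.

Lemma weight_ge1 p : 1 <= weight p.
Proof.
rewrite /weight; have := normr_ge0 (p.1%:~R : R).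
by have := normr_ge0 (p.2%:~R : R); lra.
Qed.

Lemma weight_gt0 p : 0 < weight p.
Proof. by have := weight_ge1 p; lra. Qed.

Lemma ler_sum_subset (T : eqType) (s t : seq T) (b : T -> R) : (forall i, 0 <= b i) ->
  uniq s -> {subset s <= t} -> \sum_(i <- s) b i <= \sum_(i <- t) b i.
Proof.
move=> b0; elim: s t => [|x s IH] t; first by rewrite big_nil sumr_ge0.
move=> /andP[xs us] st; rewrite (perm_big _ (perm_to_rem (st x (mem_head _ _)))).
rewrite !big_cons lerD2l; apply: IH => // y ys.
have yx : y != x by apply: contraNneq xs => <-.
have := st y; rewrite inE ys orbT => /(_ isT).
by rewrite (perm_mem (perm_to_rem (st x (mem_head _ _)))) inE (negPf yx).
Qed.

(** Each term is dominated by a telescoping difference: x^-3 <= 2/x^2 - 2/(x+1)^2 for x >= 1. *)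
Lemma sum_inv_cube (a : R) n : 1 <= a ->
  \sum_(k <- iota 0 n) (a + k%:R) ^- 3 <= 2 / a ^+ 2.
Proof.
move=> a1; suff : \sum_(k <- iota 0 n) (a + k%:R) ^- 3 <= 2 / a ^+ 2 - 2 / (a + n%:R) ^+ 2.
  by move/le_trans; apply; rewrite gerBl divr_ge0 ?sqr_ge0.
elim: n => [|n IH]; first by rewrite /= big_nil addr0 subrr.
rewrite -[in iota _ _]addn1 iotaD add0n big_cat big_seq1 -[n.+1%:R]natr1 addrA.
apply: le_trans (lerD IH (lexx _)) _.
have : 1 <= a + n%:R by have : 0 <= n%:R :> R by []; lra.
move: (a + n%:R) => x x1.
suff : x ^- 3 <= 2 / x ^+ 2 - 2 / (x + 1) ^+ 2 by lra.
rewrite -subr_ge0.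
have -> : 2 / x ^+ 2 - 2 / (x + 1) ^+ 2 - x ^- 3 = (3 * x ^+ 2 - 1) / (x ^+ 3 * (x + 1) ^+ 2).
  by field; rewrite !gt_eqF //; lra.
have x0 : 0 <= x by lra.
by rewrite divr_ge0 ?mulr_ge0 ?exprn_ge0 ?(addr_ge0 x0) //; nra.
Qed.

Lemma sum_inv_sqr n : \sum_(k <- iota 0 n) (1 + k%:R) ^- 2 <= 2 :> R.
Proof.
suff : \sum_(k <- iota 0 n) (1 + k%:R) ^- 2 <= 2 - 2 / (1 + n%:R) :> R.
  by move/le_trans; apply; rewrite gerBl divr_ge0 ?addr_ge0.
elim: n => [|n IH]; first by rewrite /= big_nil addr0 divr1 subrr.
rewrite -[in iota _ _]addn1 iotaD add0n big_cat big_seq1 -[n.+1%:R]natr1 addrA.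
apply: le_trans (lerD IH (lexx _)) _.
have : 1 <= 1 + n%:R :> R by have : 0 <= n%:R :> R by []; lra.
move: (1 + n%:R) => x x1.
suff : x ^- 2 <= 2 / x - 2 / (x + 1) by lra.
rewrite -subr_ge0.
have -> : 2 / x - 2 / (x + 1) - x ^- 2 = (x - 1) / (x ^+ 2 * (x + 1)).
  by field; rewrite !gt_eqF //; lra.
have x0 : 0 <= x by lra.
have x2 : 0 <= x ^+ 2 * (x + 1) by rewrite mulr_ge0 ?exprn_ge0 //; lra.
by rewrite divr_ge0 //; lra.
Qed.

(** Zero is listed twice: this is harmless for upper bounds, and it makes the sum of an even
    function exactly twice a one-sided sum. *)
Definition zbox n : seq int := [seq k%:Z | k <- iota 0 n] ++ [seq - k%:Z | k <- iota 0 n].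

Lemma mem_zbox n (m : int) : (`|m| < n)%N -> m \in zbox n.
Proof.
move=> mn; rewrite mem_cat; case: m mn => m /= mn.
  by apply/orP; left; apply/mapP; exists m => //; rewrite mem_iota.
by apply/orP; right; apply/mapP; exists m.+1; rewrite ?mem_iota //; lia.
Qed.

Lemma sum_zbox n (g : R -> R) :
  \sum_(m <- zbox n) g `|m%:~R| = 2 * \sum_(k <- iota 0 n) g k%:R.
Proof.
rewrite big_cat !big_map /= mulr2n mulrDl !mul1r; congr (_ + _).
  by apply: eq_bigr => k _; rewrite normr_nat.
by apply: eq_bigr => k _; rewrite mulrNz normrN normr_nat.
Qed.

Lemma summable_weight : summable (fun p => weight p ^- 3).
Proof.
split=> [p|]; first by rewrite invr_ge0 exprn_ge0 // ltW // weight_gt0.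
(* Enclose [F] in a square box. Each row sums to at most 2 * 2 / (1 + |x|)^2, and the rows together
   to at most 4 * 2 * 2. *)
exists 16 => F; pose n := (\max_(p <- F) (`|p.1| + `|p.2|)).+1%N.
apply: le_trans (ler_sum_subset (t := [seq (x, y) | x <- zbox n, y <- zbox n]) _ _ _) _.
- by move=> p; rewrite invr_ge0 exprn_ge0 // ltW // weight_gt0.
- exact: fset_uniq.
- move=> [x y] pF; have : (`|x| + `|y| < n)%N.
    rewrite ltnS.
    exact: (@leq_bigmax_seq _ _ xpredT (fun p : int * int => `|p.1| + `|p.2|)%N _ pF).
  by move=> h; apply/allpairsP; exists (x, y); split=> //; apply: mem_zbox;
    apply: leq_ltn_trans h; rewrite ?leq_addr ?leq_addl.
rewrite big_allpairs /weight /=.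
apply: (@le_trans _ _ (\sum_(x <- zbox n) 4 * (1 + `|x%:~R|) ^- 2)).
  apply: ler_sum => x _; rewrite (sum_zbox n (fun t => (1 + `|x%:~R| + t) ^- 3)).
  have h : 1 <= 1 + `|x%:~R| :> R by rewrite lerDl.
  by have := sum_inv_cube n h; lra.
rewrite -mulr_sumr (sum_zbox n (fun t => (1 + t) ^- 2)).
by have := sum_inv_sqr n; lra.
Qed.

End Weight.

(** * Growth and density of the lattice *)

Section Lattice.
Variables (R : realType) (mu : R[i]).
Hypothesis hmu : mu \isn't Num.real.
Local Notation C := R[i].
Implicit Types (z w : C) (p q : (int * int)%type).
Local Notation l := (lat mu).
Local Notation N := (@weight R).

Lemma latD p q : l (p + q) = l p + l q.
Proof. by rewrite /lat !rmorphD /=; ring. Qed.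

Lemma latN p : l (- p) = - l p.
Proof. by rewrite /lat !rmorphN /=; ring. Qed.

Lemma lat0 : l 0 = 0.
Proof. by rewrite /lat /= mul0r addr0. Qed.

Lemma Im_mu_neq0 : complex.Im mu != 0.
Proof. by apply: contra hmu; case: mu => a b /=; rewrite complex_real. Qed.

Lemma lat_ReIm p : l p =
  (p.1%:~R * complex.Re mu + p.2%:~R) +i* (p.1%:~R * complex.Im mu).
Proof.
rewrite /lat -2!(rmorph_int (real_complex R)); case: mu => a b /=.
by rewrite /real_complex_def; simpc.
Qed.

(** The imaginary part of [l p] controls the first coordinate because [mu] is not real; the real
    part then controls the second. Adding the two bounds gives the inverse of the constant. *)
Lemma lat_ge : exists2 c, 0 < c & forall p, c * (N p - 1) <= nc (l p).
Proof.
pose a := complex.Re mu; pose b := complex.Im mu.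
have b0 : 0 < `|b| by rewrite normr_gt0 Im_mu_neq0.
exists ((1 + (1 + `|a|) / `|b|)^-1).
  by rewrite invr_gt0 addr_gt0 // divr_gt0 // ltr_pwDl.
move=> p; rewrite mulrC ler_pdivrMr; last by rewrite addr_gt0 // divr_gt0 // ltr_pwDl.
have := nc_Im (l p); have := nc_Re (l p).
rewrite [complex.Re (l p)](congr1 (@complex.Re R) (lat_ReIm p)).
rewrite [complex.Im (l p)](congr1 (@complex.Im R) (lat_ReIm p)) /= -/a -/b normrM /weight.
move: (p.1%:~R : R) (p.2%:~R : R) => m n h1 h2.
have m1 : `|m| <= nc (l p) / `|b| by rewrite ler_pdivlMr.
have n1 : `|n| <= nc (l p) + `|m| * `|a|.
  by rewrite -normrM; have := ler_normB (m * a + n) (m * a); rewrite addrAC subrr add0r; lra.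
have : `|m| * `|a| <= nc (l p) / `|b| * `|a| by rewrite ler_wpM2r.
by rewrite mulrDr mulr1 mulrA [_ * (1 + _)]mulrDr mulrDl mulr1; lra.
Qed.

(** Take integer parts of the real coordinates of [z] in the basis [mu], 1; both fractional parts
    are at most 1. *)
Lemma lat_near : exists2 D, 0 < D & forall z, exists p, nc (z - l p) <= D.
Proof.
exists (nc mu + 1) => [|z]; first by rewrite ltr_wpDl ?nc_ge0.
pose t := complex.Im z / complex.Im mu; pose s := complex.Re z - t * complex.Re mu.
exists (Num.floor t, Num.floor s).
have -> : z - l (Num.floor t, Num.floor s) =
    (t - (Num.floor t)%:~R)%:C * mu + (s - (Num.floor s)%:~R)%:C.
  rewrite lat_ReIm /= /s /t; move: Im_mu_neq0.
  case: z @t @s => x y t s; case: mu => a b /= b0; simpc.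
  by congr (_ +i* _); field.
apply: le_trans (nc_triangle _ _) _; rewrite ncM !nc_real.
have fl x : `|x - (Num.floor x)%:~R| <= 1 :> R.
  rewrite ger0_norm ?subr_ge0 ?floor_le //.
  by have := floor_itv x; rewrite rmorphD /=; lra.
by apply: lerD => //; rewrite ler_piMl ?nc_ge0.
Qed.

End Lattice.

(** * Convergence and periodicity of the lattice series *)

Section WeierstrassSums.
Variables (R : realType) (mu : R[i]).
Hypothesis hmu : mu \isn't Num.real.
Local Notation C := R[i].
Implicit Types (z w : C) (p q : (int * int)%type).
Local Notation l := (lat mu).
Local Notation N := (@weight R).

Lemma weight0 : N 0 = 1.
Proof. by rewrite /weight /= normr0 !addr0. Qed.

Lemma weight_ge2 p : p != 0 -> 2 <= N p.
Proof.
have int1 (m : int) : m != 0 -> 1 <= `|m%:~R| :> R.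
  by move=> m0; rewrite -intr_norm (ler_int _ 1) -gtz0_ge1 normr_gt0.
case: p => m n; rewrite xpair_eqE negb_and /weight /=.
have := normr_ge0 (m%:~R : R); have := normr_ge0 (n%:~R : R).
by move=> n0 m0 /orP[/int1|/int1]; lra.
Qed.

(** For [p != 0] the weight is at least 2, so [N p - 1] is at least half of [N p]; at 0 the left
    side vanishes by the convention [0^-1 = 0]. *)
Lemma lat_inv : exists2 K, 0 < K & forall p, nc (l p)^-1 <= K * (N p)^-1.
Proof.
have [c c0 hc] := lat_ge hmu; exists (2 / c) => [|p]; first by rewrite divr_gt0.
have N0 := weight_gt0 R p.
have [->|p0] := eqVneq p 0; first by 
    by rewrite lat0 invr0 nc0; apply: mulr_ge0;
      rewrite ?invr_ge0 ?divr_ge0 ?(ltW c0) ?(ltW (weight_gt0 _ _)).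
have c2 : 0 < c / 2 * N p by rewrite mulr_gt0 // divr_gt0.
have h : c / 2 * N p <= nc (l p).
  by apply: le_trans (hc p); have := weight_ge2 p0; nra.
by rewrite ncV -[2 / c]invf_div -invfM lef_pV2 ?posrE // (lt_le_trans c2 h).
Qed.

Lemma lat_neq0 p : p != 0 -> l p != 0.
Proof.
have [c c0 hc] := lat_ge hmu => p0; rewrite -nc_gt0.
by apply: lt_le_trans (hc p); have := weight_ge2 p0; nra.
Qed.

Definition far (D d : R) z := nc z <= D /\ forall p, d <= nc (z - l p).

(** For large weight the linear growth of [l p] beats [nc z <= D]; for weight below 2(c + D)/c the
    gap [d] suffices. The two regimes give the two entries of the minimum [k]. *)
Lemma far_inv D d : 0 <= D -> 0 < d ->
  exists2 K, 0 < K & forall z, far D d z -> forall p, nc (z - l p)^-1 <= K * (N p)^-1.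
Proof.
move=> D0 d0; have [c c0 hc] := lat_ge hmu.
have cD : 0 < c + D by lra.
pose k := Num.min (c / 2) (d * c / (2 * (c + D))).
have k0 : 0 < k by rewrite lt_min !divr_gt0 ?mulr_gt0.
exists k^-1 => [|z [zD zd] p]; first by rewrite invr_gt0.
have N0 := weight_gt0 R p.
suff h : k * N p <= nc (z - l p).
  rewrite ncV -invfM lef_pV2 ?posrE ?mulr_gt0 //.
  by apply: lt_le_trans h; rewrite mulr_gt0.
have k1 : k <= c / 2 by rewrite ge_min lexx.
have k2 : k * (2 * (c + D)) <= d * c.
  by rewrite -ler_pdivlMr ?mulr_gt0 // ge_min lexx orbT.
have := hc p; have := zd p; have := nc_sub_ge (l p) z; rewrite ncB => h1 h2 h3.
have [big|small] := leP (2 * (c + D)) (c * N p).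
  have kN : k * N p <= c / 2 * N p by rewrite ler_pM2r.
  by lra.
apply: le_trans h2; rewrite -(ler_pM2r c0); apply: le_trans k2.
by rewrite -mulrA ler_pM2l // mulrC ltW.
Qed.

(** Off a finite set of indices the weight is at least [A], which puts [l p] at distance at least 1
    from [z]; the remaining indices contribute a positive minimum. The finite set comes from the
    summability of the weights. *)
Lemma not_lattice_far z : (forall p, z != l p) -> exists2 d, 0 < d & forall p, d <= nc (z - l p).
Proof.
move=> zl; have [c c0 hc] := lat_ge hmu.
pose A := (nc z + 1) / c + 1.
have A0 : 0 < A by rewrite ltr_wpDl // divr_ge0 ?addr_ge0 ?nc_ge0 // ltW.
have [F hF] : exists F : {fset int * int}, forall p, p \notin F -> A <= N p.
  have A3 : 0 < A ^- 3 by rewrite invr_gt0 exprn_gt0.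
  have [F hF] := summable_small (summable_weight R) A3; exists F => p /hF.
  rewrite lef_pV2 ?posrE ?exprn_gt0 ?weight_gt0 // ler_pXn2r ?nnegrE //.
    exact: ltW.
  exact/ltW/weight_gt0.
have [d d0 hd] : exists2 d, 0 < d & forall p, p \in (F : seq _) -> d <= nc (z - l p).
  elim: (F : seq _) => [|q s [d d0 hd]]; first by exists 1.
  exists (Num.min d (nc (z - l q))).
    by rewrite lt_min d0 nc_gt0 subr_eq0 zl.
  move=> p; rewrite inE => /orP[/eqP->|/hd ps]; rewrite ge_min ?lexx ?orbT //.
  by rewrite ps.
exists (Num.min d 1) => [|p]; first by rewrite lt_min d0 ltr01.
rewrite ge_min; have [pF|/hF pF] := boolP (p \in F); first by rewrite hd.
apply/orP; right; have := hc p; have := nc_sub_ge (l p) z; rewrite ncB.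
have : nc z + 1 <= c * (N p - 1).
  rewrite mulrC -ler_pdivrMr //; move: pF; rewrite /A; lra.
lra.
Qed.

(* At p = 0 the junk value 0^-1 = 0 turns this into z^-2, and makes the term at 0
   of eisG vanish. *)
Definition wp_term z p : C := (z - l p) ^- 2 - (l p) ^- 2.
Definition wp_sum z : C := usum (wp_term z).
Definition eis3 z : C := usum (fun p => (z - l p) ^- 3).
Definition eisG k : C := usum (fun p => (l p) ^- k).
(** Since ℘' is -2 [eis3], this is ℘'^2 - 4℘^3 + g2 ℘ + g3. *)
Definition wdefect z : C :=
  4 * eis3 z ^+ 2 - 4 * wp_sum z ^+ 3 + 60 * eisG 4 * wp_sum z + 140 * eisG 6.

Lemma far_bound D d : 0 <= D -> 0 < d -> exists2 K, 0 <= K & forall z, far D d z ->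
  forall p, nc (wp_term z p) <= K * N p ^- 3 /\ nc ((z - l p) ^- 3) <= K * N p ^- 3.
Proof.
move=> D0 d0; have [A A0 hA] := far_inv D0 d0; have [B B0 hB] := lat_inv.
exists (D * (A ^+ 2 * B + A * B ^+ 2) + A ^+ 2 + A ^+ 3) => [|z fz p].
  by rewrite !addr_ge0 ?mulr_ge0 ?addr_ge0 ?mulr_ge0 ?exprn_ge0 // ltW.
have := hA z fz p; have := hB p; have N1 := weight_gt0 R p.
have N3 : 0 < (N p)^-1 by rewrite invr_gt0.
have A3 : 0 <= A ^+ 2 by rewrite exprn_ge0 // ltW.
have A2 : 0 <= A ^+ 3 by rewrite exprn_ge0 // ltW.
have AB : 0 <= D * (A ^+ 2 * B + A * B ^+ 2).
  by rewrite mulr_ge0 // addr_ge0 ?mulr_ge0 ?exprn_ge0 // ltW.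
have zd : z - l p != 0 by rewrite -nc_gt0; apply: lt_le_trans d0 (fz.2 p).
move=> b a; split; last first.
  rewrite ncVX; apply: (@le_trans _ _ ((A * (N p)^-1) ^+ 3)).
    by rewrite lerXn2r ?nnegrE ?nc_ge0 // mulr_ge0 // ltW.
  rewrite exprMn exprVn ler_wpM2r ?invr_ge0 ?exprn_ge0 ?(ltW N1) //; lra.
have [p0|p0] := eqVneq p 0.
  move: a; rewrite p0 weight0 expr1n invr1 !mulr1 /wp_term lat0 expr0n invr0 !subr0 => a.
  rewrite ncVX; apply: (@le_trans _ _ (A ^+ 2)); last lra.
  by rewrite lerXn2r ?nnegrE ?nc_ge0 // ltW.
have l0 := lat_neq0 p0.
(* For a = 1/(z - l) and b = 1/l one has a + b = zab, so a^2 - b^2 = zab(a - b): three inverse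
   factors, hence cubic decay. *)
have -> : wp_term z p = z * (z - l p)^-1 ^+ 2 * (l p)^-1 - z * (z - l p)^-1 * (l p)^-1 ^+ 2.
  by rewrite /wp_term; field; rewrite zd l0.
apply: le_trans (nc_triangleB _ _) _; rewrite !ncM -!expr2.
have [zD _] := fz; rewrite -exprVn.
move: (nc_ge0 (z - l p)^-1) (nc_ge0 (l p)^-1) (nc_ge0 z) a b zD.
move: (nc (z - l p)^-1) (nc (l p)^-1) (nc z) => a b x a0 b0 x0 aA bB xD.
set n := (N p)^-1 in N3 aA bB *.
apply: (@le_trans _ _ (D * (A * n) ^+ 2 * (B * n) + D * (A * n) * (B * n) ^+ 2)).
  by apply: lerD; rewrite ler_pM ?mulr_ge0 ?exprn_ge0 // ler_pM ?exprn_ge0 // lerXn2r ?nnegrE //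
     mulr_ge0 // ltW.
have -> : D * (A * n) ^+ 2 * (B * n) + D * (A * n) * (B * n) ^+ 2 =
  D * (A ^+ 2 * B + A * B ^+ 2) * n ^+ 3 by ring.
rewrite ler_wpM2r ?exprn_ge0 ?(ltW N3) //; lra.
Qed.

Lemma wp_eis3_sum z : (forall p, z != l p) ->
  has_sum (wp_term z) (wp_sum z) /\ has_sum (fun p => (z - l p) ^- 3) (eis3 z).
Proof.
move=> zl; have [d d0 hd] := not_lattice_far zl.
have [K K0 hK] := far_bound (nc_ge0 z) d0.
have fz : far (nc z) d z by [].
have sK := summableZ K0 (summable_weight R).
have [s hs] := summable_has_sum sK (fun p => (hK z fz p).1).
have [t ht] := summable_has_sum sK (fun p => (hK z fz p).2).
by split; [exact: usumP hs|exact: usumP ht].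
Qed.

Lemma lat_inv_pow : exists2 K, 0 < K & forall k p, (3 <= k)%N ->
  nc (l p)^-1 ^+ k <= K ^+ k * N p ^- 3.
Proof.
have [K K0 hK] := lat_inv; exists K => // k p k3.
apply: (@le_trans _ _ ((K * (N p)^-1) ^+ k)).
  by rewrite lerXn2r ?nnegrE ?nc_ge0 // (le_trans (nc_ge0 _) (hK p)).
rewrite exprMn ler_wpM2l ?exprn_ge0 ?(ltW K0) // -exprVn.
have N1 := weight_ge1 R p; rewrite ler_wiXn2l //.
  by rewrite invr_ge0; lra.
by rewrite invf_le1 //; lra.
Qed.

Lemma eisG_sum k : (3 <= k)%N -> has_sum (fun p => (l p) ^- k) (eisG k).
Proof.
move=> k3; have [K K0 hK] := lat_inv_pow.
have sK := summableZ (exprn_ge0 k (ltW K0)) (summable_weight R).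
have [p|s hs] := summable_has_sum (f := fun p => (l p) ^- k) sK; last exact: usumP hs.
by rewrite ncVX hK.
Qed.

Lemma eisG_odd k : (3 <= k)%N -> odd k -> eisG k = 0.
Proof.
move=> k3 ok; apply: (has_sum_odd (h := -%R)) (eisG_sum k3); first exact: opprK.
by move=> p; rewrite latN exprNn -signr_odd ok expr1 invfM invrN1 mulN1r.
Qed.

Lemma eis3_periodic z q : (forall p, z != l p) -> eis3 (z - l q) = eis3 z.
Proof.
move=> /wp_eis3_sum[_ hz]; apply: usumE.
have := has_sum_reindex (h := fun p => p + q) (k := fun p => p - q) (addrK q) (subrK q) hz.
congr has_sum; apply: funext => p /=; rewrite latD; congr (_ ^- 3); ring.
Qed.

(* The quasi-period is a sum of terms odd under [p |-> - q - p]. *)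
Lemma wp_sum_periodic z q : (forall p, z != l p) -> wp_sum (z - l q) = wp_sum z.
Proof.
move=> zl; have zq p : z - l q != l p by rewrite subr_eq -latD zl.
have [hz _] := wp_eis3_sum zl; have [hq _] := wp_eis3_sum zq.
have hr := has_sum_reindex (h := fun p => p + q) (k := fun p => p - q) (addrK q) (subrK q) hz.
apply/eqP; rewrite -subr_eq0; apply/eqP.
apply: (has_sum_odd (h := fun p => - q - p)) (has_sumB hq hr) => [p|p] /=.
  by rewrite opprB addrCA addrN addr0.
rewrite /wp_term !latD !latN.
have -> : z - (- l q - l p + l q) = z + l p by ring.
have -> : z - l q - (- l q - l p) = z + l p by ring.
have -> : z - (l p + l q) = z - l q - l p by ring.
have -> : - l q - l p + l q = - l p by ring.
have -> : - l q - l p = - (l p + l q) by ring.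
rewrite !sqrrN; ring.
Qed.

Lemma wdefect_periodic z q : (forall p, z != l p) -> wdefect (z - l q) = wdefect z.
Proof. by move=> zl; rewrite /wdefect wp_sum_periodic // eis3_periodic. Qed.

End WeierstrassSums.

(** * Laurent expansion at the origin *)

Section ExpansionAtZero.
Variables (R : realType) (mu : R[i]).
Hypothesis hmu : mu \isn't Num.real.
Local Notation C := R[i].
Implicit Types (z w : C) (p q : (int * int)%type).
Local Notation l := (lat mu).
Local Notation N := (@weight R).
Local Notation G := (eisG mu).

(** Exact Taylor remainders: with t = z/l, the sum of (k+1)t^k over k >= 6 is t^6(7 - 6t)/(1 - t)^2,
    and likewise for the cubes from k = 5 on. The closed forms reduce the expansions to field
    identities; both vanish at [p = 0] by [0^-1 = 0]. *)
Definition rem_wp z p : C := (7 - 6 * (z * (l p)^-1)) * (l p) ^- 6 * (l p - z) ^- 2.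
Definition rem_eis3 z p : C :=
  (21 - 35 * (z * (l p)^-1) + 15 * (z * (l p)^-1) ^+ 2) * (l p) ^- 5 * (l p - z) ^- 3.

Lemma taylor_wp_term z p : l p != 0 -> z != l p ->
  wp_term mu z p = 2 * z * (l p) ^- 3 + 3 * z ^+ 2 * (l p) ^- 4
    + 4 * z ^+ 3 * (l p) ^- 5 + 5 * z ^+ 4 * (l p) ^- 6 + 6 * z ^+ 5 * (l p) ^- 7
    + z ^+ 6 * rem_wp z p.
Proof.
rewrite /wp_term /rem_wp; move: (l p) => x x0 zx.
have zx1 : z - x != 0 by rewrite subr_eq0.
have zx2 : x - z != 0 by rewrite subr_eq0 eq_sym.
by field; rewrite x0 zx1 zx2.
Qed.

Lemma taylor_eis3_term z p : l p != 0 -> z != l p ->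
  (z - l p) ^- 3 = - ((l p) ^- 3 + 3 * z * (l p) ^- 4 + 6 * z ^+ 2 * (l p) ^- 5
    + 10 * z ^+ 3 * (l p) ^- 6 + 15 * z ^+ 4 * (l p) ^- 7
    + z ^+ 5 * rem_eis3 z p).
Proof.
rewrite /rem_eis3; move: (l p) => x x0 zx.
have zx1 : z - x != 0 by rewrite subr_eq0.
have zx2 : x - z != 0 by rewrite subr_eq0 eq_sym.
by field; rewrite x0 zx1 zx2.
Qed.

(** Here |t| <= 1/2 bounds the numerators by 10 and 43, and |l - z| >= |l|/2 costs factors 4 and
    8. *)
Lemma rem_bound z p : l p != 0 -> 2 * nc z <= nc (l p) ->
  nc (rem_wp z p) <= 40 * nc (l p)^-1 ^+ 8 /\ nc (rem_eis3 z p) <= 344 * nc (l p)^-1 ^+ 8.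
Proof.
move=> l0 zl; have L0 : 0 < nc (l p) by rewrite nc_gt0.
have iv : nc (l p - z)^-1 <= 2 * nc (l p)^-1.
  rewrite !ncV -[2]invrK -invfM lef_pV2 ?posrE ?mulr_gt0 ?invr_gt0 //.
    by have := nc_sub_ge (l p) z; lra.
  by have := nc_sub_ge (l p) z; lra.
have tle : nc (z * (l p)^-1) <= 2^-1.
  by rewrite ncM ncV ler_pdivrMr //; lra.
rewrite /rem_wp /rem_eis3; move: (z * (l p)^-1) tle => t tle.
have b1 : nc (7 - 6 * t) <= 10.
  by apply: le_trans (nc_triangleB _ _) _; rewrite ncM !nc_nat; lra.
have b2 : nc (21 - 35 * t + 15 * t ^+ 2) <= 43.
  apply: le_trans (nc_triangle _ _) _.
  apply: le_trans (lerD (nc_triangleB _ _) (lexx _)) _.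
  by rewrite !ncM !nc_nat; have := nc_ge0 t; nra.
rewrite !(ncM, ncVX); have u0 := nc_ge0 (l p)^-1; have v0 := nc_ge0 (l p - z)^-1.
move: (nc (l p)^-1) (nc (l p - z)^-1) u0 v0 iv => u v u0 v0 iv.
split.
  have -> : 40 * u ^+ 8 = 10 * u ^+ 6 * (2 * u) ^+ 2 by ring.
  by rewrite ler_pM ?mulr_ge0 ?exprn_ge0 ?nc_ge0 // ?ler_wpM2r ?exprn_ge0 //
    lerXn2r ?nnegrE ?mulr_ge0.
have -> : 344 * u ^+ 8 = 43 * u ^+ 5 * (2 * u) ^+ 3 by ring.
by rewrite ler_pM ?mulr_ge0 ?exprn_ge0 ?nc_ge0 // ?ler_wpM2r ?exprn_ge0 //
    lerXn2r ?nnegrE ?mulr_ge0.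
Qed.

Lemma expansion_at0 : exists d K, [/\ 0 < d, d <= 1, 0 <= K & forall z, z != 0 -> nc z <= d ->
  exists r s, [/\ nc r <= K, nc s <= K,
    wp_sum mu z = z ^- 2 + 3 * G 4 * z ^+ 2 + 5 * G 6 * z ^+ 4 + r * z ^+ 6 &
    eis3 mu z = z ^- 3 - 3 * G 4 * z - 10 * G 6 * z ^+ 3 - s * z ^+ 5]].
Proof.
have [c c0 hc] := lat_ge hmu; have [K K0 hK] := lat_inv_pow hmu.
have lc p : p != 0 -> c <= nc (l p).
  by move=> p0; apply: le_trans (hc p); have := weight_ge2 R p0; nra.
have sK := summableZ (exprn_ge0 8 (ltW K0)) (summable_weight R).
have sK' := summableZ (ler0n R 344) sK.
have [B hB] : exists B, forall F : {fset int * int},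
    \sum_(p <- F) 344 * (K ^+ 8 * N p ^- 3) <= B by case: sK'.
have B0 : 0 <= B by have := hB fset0; rewrite big_nil.
exists (Num.min (c / 2) 1), B; split=> //; first by rewrite lt_min ltr01 divr_gt0.
  by rewrite ge_min lexx orbT.
move=> z z0 zd; have zc : 2 * nc z <= c.
  by move: zd; rewrite le_min => /andP[h _]; lra.
have zl p : z != l p.
  have [->|p0] := eqVneq p 0; first by rewrite lat0.
  apply: contraTneq zc => ->; have := lc p p0; lra.
have [hw he] := wp_eis3_sum hmu zl.
have rb p : nc (rem_wp z p) <= 344 * (K ^+ 8 * N p ^- 3) /\
    nc (rem_eis3 z p) <= 344 * (K ^+ 8 * N p ^- 3).
  have [->|p0] := eqVneq p 0.
    rewrite /rem_wp /rem_eis3 lat0 !expr0n !invr0 !(mulr0, mul0r) nc0.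
    by rewrite !mulr_ge0 ?invr_ge0 ?exprn_ge0 ?(ltW K0) ?(ltW (weight_gt0 _ _)).
  have [h1 h2] := rem_bound (lat_neq0 hmu p0) (le_trans zc (lc p p0)).
  have := hK 8%N p isT; have : 0 <= nc (l p)^-1 ^+ 8 by rewrite exprn_ge0 ?nc_ge0.
  by split; lra.
have [r hr] := summable_has_sum sK' (fun p => (rb p).1).
have [s hs] := summable_has_sum sK' (fun p => (rb p).2).
exists r, s; split.
- exact: has_sum_le hr (fun p => (rb p).1) hB.
- exact: has_sum_le hs (fun p => (rb p).2) hB.
(* The index 0 contributes only the polar part; the Taylor terms vanish there. Summing them over the
   other indices leaves only the even Eisenstein sums. *)
- have h0 := has_sum_pred1 (0 : int * int) (z ^- 2).
  have H := has_sumD (has_sumD (has_sumD (has_sumD (has_sumD (has_sumD h0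
    (has_sumZ (2 * z) (eisG_sum hmu (k := 3) isT)))
    (has_sumZ (3 * z ^+ 2) (eisG_sum hmu (k := 4) isT)))
    (has_sumZ (4 * z ^+ 3) (eisG_sum hmu (k := 5) isT)))
    (has_sumZ (5 * z ^+ 4) (eisG_sum hmu (k := 6) isT)))
    (has_sumZ (6 * z ^+ 5) (eisG_sum hmu (k := 7) isT)))
    (has_sumZ (z ^+ 6) hr).
  rewrite (eisG_odd hmu (k := 3)) // (eisG_odd hmu (k := 5)) // (eisG_odd hmu (k := 7)) // in H.
  transitivity (z ^- 2 + 2 * z * 0 + 3 * z ^+ 2 * G 4 + 4 * z ^+ 3 * 0 + 5 * z ^+ 4 * G 6 +
    6 * z ^+ 5 * 0 + z ^+ 6 * r); last by ring.
  apply: has_sum_uniq hw _; apply: eq_has_sum H => p.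
  have [->|p0] := eqVneq p 0.
    by rewrite /rem_wp /wp_term lat0 !expr0n !invr0 !(mulr0, mul0r, addr0, subr0).
  by rewrite add0r taylor_wp_term // lat_neq0.
have h0 := has_sum_pred1 (0 : int * int) (z ^- 3).
have H := has_sumB h0 (has_sumD (has_sumD (has_sumD (has_sumD (has_sumD
    (eisG_sum hmu (k := 3) isT)
    (has_sumZ (3 * z) (eisG_sum hmu (k := 4) isT)))
    (has_sumZ (6 * z ^+ 2) (eisG_sum hmu (k := 5) isT)))
    (has_sumZ (10 * z ^+ 3) (eisG_sum hmu (k := 6) isT)))
    (has_sumZ (15 * z ^+ 4) (eisG_sum hmu (k := 7) isT)))
    (has_sumZ (z ^+ 5) hs)).
rewrite (eisG_odd hmu (k := 3)) // (eisG_odd hmu (k := 5)) // (eisG_odd hmu (k := 7)) // in H.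
transitivity (z ^- 3 - (0 + 3 * z * G 4 + 6 * z ^+ 2 * 0 + 10 * z ^+ 3 * G 6 +
  15 * z ^+ 4 * 0 + z ^+ 5 * s)); last by ring.
apply: has_sum_uniq he _; apply: eq_has_sum H => p.
have [->|p0] := eqVneq p 0.
  by rewrite /rem_eis3 lat0 !expr0n !invr0 !(mulr0, mul0r, addr0, subr0).
by rewrite sub0r taylor_eis3_term // lat_neq0.
Qed.

(* The polar parts and constant terms cancel, whatever the remainders. *)
Lemma wdefect_at0 : exists d K, [/\ 0 < d, 0 <= K &
  forall z, z != 0 -> nc z <= d -> nc (wdefect mu z) <= K * nc z].
Proof.
have [d [K [d0 d1 K0 h]]] := expansion_at0.
pose a := 3 * nc (G 4) + 5 * nc (G 6) + K; pose e := 3 * nc (G 4) + 10 * nc (G 6) + K.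
have G0 := nc_ge0 (G 4); have G60 := nc_ge0 (G 6).
have a0 : 0 <= a by rewrite /a; lra.
have e0 : 0 <= e by rewrite /e; lra.
exists d, (20 * K + 4 * e ^+ 2 + 12 * a ^+ 2 + 4 * a ^+ 3 + 60 * nc (G 4) * a); split=> //.
  by rewrite !addr_ge0 ?mulr_ge0 ?exprn_ge0.
move=> z z0 zd; have [r [s [rK sK wE eE]]] := h z z0 zd.
(* Thus [wp_sum] is z^-2 + z^2 [al] and [eis3] is z^-3 - z [et], with [al] and [et] bounded by [a]
   and [e] for |z| <= 1. *)
pose al := 3 * G 4 + 5 * G 6 * z ^+ 2 + r * z ^+ 4.
pose et := 3 * G 4 + 10 * G 6 * z ^+ 2 + s * z ^+ 4.
have z1 : nc z <= 1 by lra.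
have zn n : nc (z ^+ n) <= 1 by rewrite ncX exprn_ile1 ?nc_ge0.
have al_le : nc al <= a.
  apply: le_trans (nc_triangle _ _) _; apply: lerD.
    apply: le_trans (nc_triangle _ _) _; apply: lerD; first by rewrite ncM nc_nat.
    by rewrite 2!ncM nc_nat ler_piMr ?mulr_ge0.
  by rewrite ncM; apply: le_trans rK; rewrite ler_piMr ?nc_ge0.
have et_le : nc et <= e.
  apply: le_trans (nc_triangle _ _) _; apply: lerD.
    apply: le_trans (nc_triangle _ _) _; apply: lerD; first by rewrite ncM nc_nat.
    by rewrite 2!ncM nc_nat ler_piMr ?mulr_ge0.
  by rewrite ncM; apply: le_trans sK; rewrite ler_piMr ?nc_ge0.
have -> : wdefect mu z = z * (z * (- (8 * s) - 12 * r + 4 * et ^+ 2 - 12 * al ^+ 2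
    - z ^+ 4 * (4 * al ^+ 3) + 60 * G 4 * al)).
  by rewrite /wdefect wE eE /al /et; field.
rewrite ncM mulrC ler_wpM2r ?nc_ge0 // ncM.
apply: le_trans (ler_piMl (nc_ge0 _) z1) _.
have tB (x y : C) (X Y : R) : nc x <= X -> nc y <= Y -> nc (x - y) <= X + Y.
  by move=> hx hy; apply: le_trans (nc_triangleB _ _) (lerD hx hy).
have tD (x y : C) (X Y : R) : nc x <= X -> nc y <= Y -> nc (x + y) <= X + Y.
  by move=> hx hy; apply: le_trans (nc_triangle _ _) (lerD hx hy).
have tX (x : C) (X : R) n : nc x <= X -> nc (x ^+ n) <= X ^+ n.
  by move=> hx; rewrite ncX lerXn2r ?nnegrE ?nc_ge0 // (le_trans (nc_ge0 _) hx).
have tn (n : nat) (x : C) (X : R) : nc x <= X -> nc (n%:R * x) <= n%:R * X.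
  by move=> hx; rewrite ncM nc_nat ler_wpM2l.
have -> : 20 * K + 4 * e ^+ 2 + 12 * a ^+ 2 + 4 * a ^+ 3 + 60 * nc (G 4) * a =
  8 * K + 12 * K + 4 * e ^+ 2 + 12 * a ^+ 2 + 4 * a ^+ 3 + 60 * nc (G 4) * a by ring.
apply: (tD); last by rewrite 2!ncM nc_nat ler_wpM2l ?mulr_ge0.
apply: (tB); last first.
  by rewrite ncM; apply: le_trans (ler_piMl (nc_ge0 _) (zn 4)) _; apply/tn/tX.
apply: (tB); last by apply/tn/tX.
apply: (tD); last by apply/tn/tX.
by apply: (tB); [rewrite ncN; apply: (tn)|apply: (tn)].
Qed.

End ExpansionAtZero.

(** * Vanishing of the defect *)

Section Vanishing.
Variables (R : realType) (mu : R[i]).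
Hypothesis hmu : mu \isn't Num.real.
Local Notation C := R[i].
Implicit Types (z w : C) (p q : (int * int)%type).
Local Notation l := (lat mu).
Local Notation G := (eisG mu).

Lemma far_not_lattice D d z : 0 < d -> far mu D d z -> forall p, z != l p.
Proof.
move=> d0 [_ h] p; rewrite -subr_eq0 -nc_gt0; exact: lt_le_trans d0 (h p).
Qed.

Lemma wdefect_far_bounded D d : 0 <= D -> 0 < d ->
  exists2 M, 0 <= M & forall z, far mu D d z -> nc (wdefect mu z) <= M.
Proof.
move=> D0 d0; have [K K0 hK] := far_bound hmu D0 d0.
have [_ [B hB]] := summableZ K0 (summable_weight R).
have B0 : 0 <= B by have := hB fset0; rewrite big_nil.
exists (4 * B ^+ 2 + 4 * B ^+ 3 + 60 * nc (G 4) * B + 140 * nc (G 6)) => [|z fz].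
  by rewrite !addr_ge0 ?mulr_ge0 ?exprn_ge0 ?nc_ge0.
have [hw he] := wp_eis3_sum hmu (far_not_lattice d0 fz).
have wB := has_sum_le hw (fun p => (hK z fz p).1) hB.
have eB := has_sum_le he (fun p => (hK z fz p).2) hB.
apply: le_trans (nc_triangle _ _) _; apply: lerD; last by rewrite ncM nc_nat.
apply: le_trans (nc_triangle _ _) _; apply: lerD; last first.
  by rewrite 2!ncM nc_nat ler_wpM2l ?mulr_ge0 ?nc_ge0.
apply: le_trans (nc_triangleB _ _) _.
by apply: lerD; rewrite ncM nc_nat ler_pM2l // ncX lerXn2r ?nnegrE ?nc_ge0.
Qed.

(** The disc of radius [nc w] about [z0] keeps distance [d] from the lattice. Partial sums are built
    from inverses with poles outside it, and the M-test passes to the limit. *)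
Lemma wdefect_disc z0 w d : 0 < d -> (forall p, nc w + d <= nc (z0 - l p)) ->
  disc_algebra (fun h => wdefect mu (z0 + w * h)).
Proof.
move=> d0 hd; have D0 : 0 <= nc z0 + nc w by rewrite addr_ge0 ?nc_ge0.
have [K K0 hK] := far_bound hmu D0 d0.
have sK := summableZ K0 (summable_weight R).
have fh h : nc h <= 1 -> far mu (nc z0 + nc w) d (z0 + w * h).
  move=> h1; have wh : nc (w * h) <= nc w by rewrite ncM ler_piMr ?nc_ge0.
  split=> [|p]; first by have := nc_triangle z0 (w * h); lra.
  have -> : z0 + w * h - l p = (z0 - l p) - (- (w * h)) by ring.
  by have := nc_sub_ge (z0 - l p) (- (w * h)); rewrite ncN; have := hd p; lra.
have dinv p : disc_algebra (fun h => (z0 + w * h - l p)^-1).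
  under eq_fun do rewrite addrAC.
  by apply: disc_algebra_inv; have := hd p; lra.
have dpow p n : disc_algebra (fun h => (z0 + w * h - l p) ^- n).
  by under eq_fun do rewrite -exprVn; apply: disc_algebraX.
have dw : disc_algebra (fun h => wp_sum mu (z0 + w * h)).
  apply: disc_algebra_lim => e /(summable_uniform sK)[F0 hF].
  exists (fun h => \sum_(p <- F0) wp_term mu (z0 + w * h) p).
    by apply: disc_algebra_sum => p; apply: disc_algebraD (disc_algebra_cst _).
  move=> h h1; apply: hF (wp_eis3_sum hmu (far_not_lattice d0 (fh h h1))).1.
  by move=> p; exact: (hK _ (fh h h1) p).1.
have de : disc_algebra (fun h => eis3 mu (z0 + w * h)).
  apply: disc_algebra_lim => e /(summable_uniform sK)[F0 hF].
  exists (fun h => \sum_(p <- F0) (z0 + w * h - l p) ^- 3).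
    by apply: disc_algebra_sum => p.
  move=> h h1; apply: hF (wp_eis3_sum hmu (far_not_lattice d0 (fh h h1))).2.
  by move=> p; exact: (hK _ (fh h h1) p).2.
have dc (c : C) f : disc_algebra f -> disc_algebra (fun h => c * f h).
  exact: disc_algebraM (disc_algebra_cst c).
rewrite /wdefect; under eq_fun do rewrite -mulNr.
apply: disc_algebraD; last exact: disc_algebra_cst.
apply: disc_algebraD; last exact: (dc).
by apply: disc_algebraD; apply: (dc); apply: disc_algebraX.
Qed.

Lemma wdefect_near_lattice e : 0 < e -> exists2 d, 0 < d &
  forall z p, (forall q, z != l q) -> nc (z - l p) <= d -> nc (wdefect mu z) <= e.
Proof.
move=> e0; have [d [K [d0 K0 h]]] := wdefect_at0 hmu.
have K1 : 0 < K + 1 by lra.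
exists (Num.min d (e / (K + 1))) => [|z p zl]; first by rewrite lt_min d0 divr_gt0.
rewrite le_min => /andP[zd ze]; rewrite -(wdefect_periodic hmu p zl).
apply: le_trans (h _ _ zd) _; first by rewrite subr_eq0.
move: ze; rewrite ler_pdivlMr // mulrC; have := nc_ge0 (z - l p); lra.
Qed.

(** Close to the lattice the defect is at most 1; any other point can be translated by a lattice
    vector into a region [far mu D d]. *)
Lemma wdefect_bounded : exists2 M, 0 <= M &
  forall z, (forall p, z != l p) -> nc (wdefect mu z) <= M.
Proof.
have [d d0 hd] := wdefect_near_lattice ltr01.
have [D D0 hD] := lat_near hmu.
have [M M0 hM] := wdefect_far_bounded (ltW D0) d0.
exists (1 + M) => [|z zl]; first lra.
have [[p pd]|h] := pselect (exists p, nc (z - l p) <= d).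
  by have := hd z p zl pd; lra.
have [p pD] := hD z; rewrite -(wdefect_periodic hmu p zl).
suff /hM : far mu D d (z - l p) by lra.
split=> // q; rewrite leNgt; apply/negP => /ltW lt; apply: h; exists (p + q).
by rewrite latD opprD addrA.
Qed.

(* The disc about a near-maximum [z0] that almost reaches the nearest lattice
   point contradicts the strong maximum principle. *)
Lemma wdefect_eq0 z : (forall p, z != l p) -> wdefect mu z = 0.
Proof.
move=> zl; apply/eqP; rewrite -nc_eq0; apply/negP => /negP fz.
have fz0 : 0 < nc (wdefect mu z) by rewrite lt_def fz nc_ge0.
have [M M0 hM] := wdefect_bounded.
pose A : set R := fun x => exists2 y, (forall p, y != l p) & x = nc (wdefect mu y).
have hA : has_sup A.
  by split; [exists (nc (wdefect mu z)), z|exists M => x [y yl ->]; exact: hM].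
pose S := sup A.
have fS y : (forall p, y != l p) -> nc (wdefect mu y) <= S.
  by move=> yl; apply: ub_le_sup; [exact: hA.2|exists y].
have S0 : 0 < S by apply: lt_le_trans fz0 (fS _ zl).
have [d d0 hd] := wdefect_near_lattice (divr_gt0 S0 (ltr0n R 2)).
have [D D0 hD] := lat_near hmu.
have dD0 : 0 < (d / (2 * D)) ^+ 2 / 4 by rewrite divr_gt0 ?exprn_gt0 ?divr_gt0 ?mulr_gt0.
(* This [k] makes the arc of [disc_strong_max] so short that [nc (h - 1) <= d / (2 * D)] on it. *)
have [k hk] := geometric_small (q := 2^-1) ltac:(lra) dD0.
pose t : R := (8 * 2 ^+ k)^-1.
have k1 : 1 <= 2 ^+ k :> R by rewrite exprn_ege1 // ler1n.
have t0 : 0 < t by rewrite invr_gt0; lra.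
have t8 : t <= 8^-1 by rewrite lef_pV2 ?posrE //; lra.
have [x [z0 z0l ->] lt] := sup_adherent (mulr_gt0 S0 t0) hA.
(* Within [d] of the lattice the defect is at most [S / 2], which is below the value at [z0]. *)
have sep p : d <= nc (z0 - l p).
  rewrite leNgt; apply/negP => /ltW /(hd z0 p z0l); move: lt; rewrite -/S; nra.
pose B : set R := fun x => exists p, x = nc (z0 - l p).
have hB : has_inf B.
  by split; [exists (nc (z0 - l 0)), 0|exists d => x0 [p ->]].
pose b := inf B.
have bB p : b <= nc (z0 - l p) by apply: ge_inf; [exact: hB.2|exists p].
have db : d <= b by apply: lb_le_inf; [exact: hB.1|move=> x0 [p ->]].
have bD : b <= D by have [p pD] := hD z0; exact: le_trans (bB p) pD.
have d4 : 0 < d / 4 by lra.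
(* [p0] is a nearest index up to [d / 4]. Radius [b - d / 4] leaves a margin [d / 4] to the whole
   lattice, while the boundary point towards [l p0] is within [d / 2] of it. *)
have [rho [p0 rhoE] rb] := inf_adherent d4 hB; rewrite -/b in rb.
have rho0 : 0 < rho by have := bB p0; rewrite -rhoE; lra.
pose r := b - d / 4; pose w := (r / rho)%:C * (l p0 - z0).
have r0 : 0 < r by rewrite /r; lra.
have nw : nc w = r.
  by rewrite ncM nc_real ncB -rhoE ger0_norm ?divfK ?gt_eqF // divr_ge0 // ltW.
have zw : nc (z0 + w - l p0) <= d / 2.
  have -> : z0 + w - l p0 = (1 - r / rho)%:C * (z0 - l p0).
    by rewrite /w rmorphB; ring.
  rewrite ncM nc_real -rhoE ger0_norm.
    by rewrite mulrBl mul1r divfK ?gt_eqF // /r; lra.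
  by rewrite subr_ge0 ler_pdivrMr // mul1r /r; have := bB p0; rewrite -rhoE; lra.
have wd p : nc w + d / 4 <= nc (z0 - l p).
  by have := bB p; rewrite nw /r; lra.
have hl h : nc h <= 1 -> forall p, z0 + w * h != l p.
  move=> h1 p; rewrite -subr_eq0 -nc_gt0.
  have wh : nc (w * h) <= nc w by rewrite ncM ler_piMr ?nc_ge0.
  have -> : z0 + w * h - l p = (z0 - l p) - (- (w * h)) by ring.
  by have := nc_sub_ge (z0 - l p) (- (w * h)); rewrite ncN; have := wd p; lra.
have := disc_strong_max (k := k) (wdefect_disc d4 wd) S0.
rewrite mulr0 addr0 -/t => H.
suff : nc (wdefect mu z0) <= S * (1 - t) by move: lt; rewrite -/S; lra.
apply: H => [h h1|h h1 hk1]; first by apply: fS; apply: hl; rewrite h1.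
apply: (hd _ p0); first by apply: hl; rewrite h1.
have -> : z0 + w * h - l p0 = (z0 + w - l p0) + w * (h - 1) by ring.
apply: le_trans (nc_triangle _ _) _; rewrite ncM nw.
(* Since [r <= D], moving along the arc costs at most another [d / 2], so the arc stays within [d]
   of [l p0]. *)
have h2 : nc (h - 1) <= d / (2 * D).
  rewrite -(@ler_pXn2r _ 2) ?nnegrE ?nc_ge0 //; last by rewrite divr_ge0 ?mulr_ge0 // ltW.
  by apply: le_trans hk1 _; move: hk; rewrite exprVn; lra.
have : r * nc (h - 1) <= D * (d / (2 * D)).
  by apply: ler_pM => //; rewrite ?nc_ge0 ?(ltW r0) // /r; lra.
rewrite (_ : D * _ = d / 2); last by field; rewrite gt_eqF.
lra.
Qed.

End Vanishing.

(** * The defect of finite partial sums *)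

Section FiniteSums.
Variables (R : realType) (mu : R[i]).
Local Notation C := R[i].
Local Open Scope fset_scope.
Local Open Scope ring_scope.

Definition fin_pow k (A : {fset int * int}) (z : C) := \sum_(p <- A) (z - lat mu p) ^- k.
Definition fin_eis k (A : {fset int * int}) : C := \sum_(p <- A `\ (0, 0)) (lat mu p) ^- k.

Definition weierstrass_cubic (g1 g2 g3 X Y : C) : C :=
  Y ^+ 2 - 4 * X ^+ 3 + 12 * g1 * X ^+ 2 - (12 * g1 ^+ 2 - g2) * X
  + (4 * g1 ^+ 3 - g1 * g2 + g3).

Definition fin_defect A z := weierstrass_cubic (fin_eis 2 A) (60 * fin_eis 4 A)
  (140 * fin_eis 6 A) (fin_pow 2 A z) (- 2 * fin_pow 3 A z).

Lemma fin_eisE k A : (0 < k)%N -> fin_eis k A = \sum_(p <- A) (lat mu p) ^- k.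
Proof.
move=> k0; rewrite /fin_eis; have [A0|A0] := boolP ((0, 0) \in A).
  rewrite [RHS](big_fsetD1 (0, 0)) //= (_ : lat mu (0, 0) = 0) ?lat0 //.
  by rewrite expr0n gtn_eqF // invr0 add0r.
suff -> : A `\ (0, 0) = A by [].
apply/fsetP => p; rewrite !inE andbC; case: (boolP (p \in A)) => //= pA.
by apply: contraNneq A0 => <-.
Qed.

(** Over a finite set the [wp_term]s sum to [X - g1], so the cubic is the classical one at [X - g1].
    Only this difference is passed to the limit, not [X] and [g1] separately. *)
Lemma fin_defect_small (hmu : mu \isn't Num.real) z : (forall p, z != lat mu p) ->
  forall e, 0 < e -> exists F0 : {fset int * int}, forall F, F0 `<=` F ->
    Normc.normc (fin_defect F z) <= e.
Proof.
move=> zl e e0; have [hw he] := wp_eis3_sum hmu zl.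
have h4 := eisG_sum hmu (k := 4) isT; have h6 := eisG_sum hmu (k := 6) isT.
have H : tends (fun F => 4 * (\sum_(p <- F) (z - lat mu p) ^- 3) ^+ 2
    - 4 * (\sum_(p <- F) wp_term mu z p) ^+ 3
    + 60 * (\sum_(p <- F) lat mu p ^- 4) * (\sum_(p <- F) wp_term mu z p)
    + 140 * (\sum_(p <- F) lat mu p ^- 6)) (wdefect mu z).
  apply: tendsD (tendsMl _ h6); apply: tendsD (tendsM (tendsMl _ h4) hw).
  by apply: tendsB; apply: tendsMl; apply: tendsX.
have [F0 hF] := H e e0; exists F0 => F /hF; rewrite wdefect_eq0 // subr0.
congr (Normc.normc _ <= _).
rewrite /fin_defect /weierstrass_cubic !fin_eisE // /wp_term sumrB /fin_pow.
ring.
Qed.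

End FiniteSums.

(** * Transfer to the ultrapower *)

Section Represents.
Variables (I : Type) (U : ultrafilter_on I) (T : comNzRingType).
Implicit Types (x y : ultrapower U T) (s t : I -> T).

Definition represents x s := x = uclass U s.

Lemma representsD x y s t :
  represents x s -> represents y t -> represents (x + y) (fun i => s i + t i).
Proof. by move=> -> ->; exact: umap2E. Qed.

Lemma representsN x s : represents x s -> represents (- x) (fun i => - s i).
Proof. by move=> ->; exact: umapE. Qed.

Lemma representsM x y s t :
  represents x s -> represents y t -> represents (x * y) (fun i => s i * t i).
Proof. by move=> -> ->; exact: umap2E. Qed.

Lemma representsX x s n : represents x s -> represents (x ^+ n) (fun i => s i ^+ n).
Proof.
move=> xs; elim: n => [//|n IH]; rewrite exprS /represents.
by under eq_fun do rewrite exprS; exact: representsM.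
Qed.

Lemma represents_nat n : represents n%:R (fun=> n%:R).
Proof.
elim: n => [//|n IH]; rewrite -natr1 /represents.
by under eq_fun do rewrite -natr1; exact: representsD IH _.
Qed.

End Represents.

Section Transfer.
Variable V : ultrafilter_on nat.
Local Open Scope classical_set_scope.
Local Open Scope ring_scope.

(** By the ultrafilter property the union of [F i] and [G i] represents the same internal set as
    [G]; injectivity of the representation then applies. *)
Lemma internal_fset_subset (F G : nat -> {fset int * int}) :
  @internal_fset V F `<=` @internal_fset V G -> V [set i | (F i `<=` G i)%fset].
Proof.
move=> FG; suff /internal_fset_inj :
    @internal_fset V (fun i => (F i `|` G i)%fset) = @internal_fset V G.
  by apply: filterS => i /= <-; exact: fsubsetUl.
rewrite predeqE; elim/ultrapowerW=> s; split=> [/internal_uclass h|/internal_uclass h].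
  have [sF|nF] := in_ultra_setVsetC [set i | s i \in F i] (ultra_setsP V).
    by apply/FG/internal_uclass.
  apply/internal_uclass; apply: filterS2 h nF => i /=.
  by rewrite in_fsetU => /orP[].
by apply/internal_uclass; apply: filterS h => i /=; rewrite in_fsetU => ->; rewrite orbT.
Qed.

Lemma internal_fset_del0 (F : nat -> {fset int * int}) :
  @internal_fset V F `\` [set 0] = @internal_fset V (fun i => (F i `\ (0, 0)%R)%fset).
Proof.
rewrite predeqE; elim/ultrapowerW=> s; split.
  move=> [/internal_uclass sF s0]; apply/internal_uclass.
  have [s00|] := in_ultra_setVsetC [set i | s i = (0, 0)] (ultra_setsP V).
    by case: s0; apply/uclass_eq.
  by apply: filterS2 sF => i /= sF /eqP s0i; rewrite !inE s0i.
move=> /internal_uclass sF; split.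
  by apply/internal_uclass; apply: filterS sF => i /=; rewrite !inE => /andP[].
move=> /uclass_eq s0; have [i [/= + s0i]] := filter_ex (filterI sF s0).
by rewrite s0i !inE eqxx.
Qed.

Lemma E_uclass (R : realType) (mu : R[i]) (F : hyperfinite V) (s : nat -> R[i]) :
  let z := uclass V s in
  E mu F (wp mu F z) (wp' mu F z) = uclass V (fun i => fin_defect mu (hf_seq F i) (s i)).
Proof.
move=> z; have FE := esym (hf_seqE F).
have wE k : hf_sum F (umap (fun w p => (w - lat mu p) ^- k) z) =
    uclass V (fun i => fin_pow mu k (hf_seq F i) (s i)).
  by rewrite /z umapE (hf_sumE _ FE).
have eE k : eisenstein mu k F = uclass V (fun i => fin_eis mu k (hf_seq F i)).
  rewrite /eisenstein /uconst (@hf_sumE _ _ _ (fun i => (hf_seq F i `\ (0, 0)%R)%fset)) //.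
  by rewrite /= -internal_fset_del0 hf_seqE.
rewrite -/(represents _ _) /E /wp /wp' /g1 /g2 /g3 /fin_defect /weierstrass_cubic.
by do ?[exact: wE | exact: eE | exact: represents_nat | apply: representsX
  | apply: representsN | apply: representsM | apply: representsD].
Qed.

End Transfer.

Theorem theorem4 (R : realType) (V : ultrafilter_on nat)
    (hV : nonprincipal V) (mu : R[i]) (hmu : mu \isn't Num.real)
    (z : ultrapower V R[i]) (hz : ~ starLambda mu z)
    (u : ultrafilter_on (hyperfinite V)) (hu : Cone u) :
  star_infinitesimal (uclass u (fun F => E mu F (wp mu F z) (wp' mu F z))).
Proof.
move: hz; elim/ultrapowerW: z => s hz.
elim/ultrapowerW=> e /ultE e0.
rewrite /diamond_abs umapE; apply/ultE.
have zs : V [set i | forall p, s i != lat mu p]%classic.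
  have [h|h] := in_ultra_setVsetC [set i | Lambda mu (s i)]%classic (ultra_setsP V).
    by case: hz; apply/internal_uclass.
  by apply: filterS h => i /= h p; apply/eqP => sp; apply: h; exists p.
(* Coordinates where [s i] is a lattice point or [e i] is not positive receive the empty set; they
   are negligible for [V]. The bound [e i / 2] makes the final inequality strict. *)
have /choice[F0 hF0] : forall i, exists F0 : {fset int * int},
    (forall p, s i != lat mu p) -> 0 < e i ->
    forall F, (F0 `<=` F)%fset -> Normc.normc (fin_defect mu F (s i)) <= e i / 2.
  move=> i; have [si|si] := pselect (forall p, s i != lat mu p); last by exists fset0.
  have [ei|ei] := ltP 0 (e i); last by exists fset0.
  have [F0 h] := fin_defect_small hmu si (divr_gt0 ei (ltr0n R 2)).
  by exists F0 => _ _.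
have hF : exists F, @internal_fset V F0 = @internal_fset V F by exists F0.
(* The cone above the class of [F0] belongs to [u], and each of its members contains [F0 i] for
   [V]-almost all [i]. *)
apply: filterS (hu (Hyperfinite hF)) => F /=; rewrite -(hf_seqE F) => /internal_fset_subset sub.
rewrite E_uclass /star_abs umapE; apply/ultE.
move: sub; apply: filterS3 zs e0 => i /= si ei sub.
by apply: le_lt_trans (hF0 i si ei _ sub) _; rewrite ltr_pdivrMr // ltr_pMr // ltr1n.
Qed.
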